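(* Let $1\le r\le\min\{p_1,p_2\}$, $U\in\mathrm{St}(r,p_1)$, $Y\in\mathbb{R}^{p_2\times r}_*$ and $X=UY^\top$. Suppose the weights in $\bar g^r_{(U,Y)}$ satisfy $V_Y=OV_{YO}O^\top$ and $W_Y=OW_{YO}O^\top$ for all $Y\in\mathbb{R}^{p_2\times r}_*$, $O\in\mathbb{O}_r$. Then $$\operatorname{grad}f(X)=\overline{\operatorname{grad}_Uh_r([U,Y])}\,V_YY^\dagger+\big(\overline{\operatorname{grad}_Yh_r([U,Y])}\,W_YU^\top\big)^\top,$$ $$\overline{\operatorname{grad}h_r([U,Y])}=\begin{bmatrix}\overline{\operatorname{grad}_Uh_r([U,Y])}\\ \overline{\operatorname{grad}_Yh_r([U,Y])}\end{bmatrix}=\begin{bmatrix}P_{U_\perp}\operatorname{grad}f(X)\,Y\,V_Y^{-1}\\(\operatorname{grad}f(X))^\top U\,W_Y^{-1}\end{bmatrix}.$$ Furthermore, if $[U,Y]$ is a Riemannian first-order stationary point of $h_r$ on $\mathcal{M}^{q_3}_r$, then $$\overline{\operatorname{Hess}h_r([U,Y])}[\theta_{(U,Y)},\theta_{(U,Y)}]=\operatorname{Hess}f(X)\big[\mathcal{L}^r_{U,Y}(\theta_{(U,Y)}),\mathcal{L}^r_{U,Y}(\theta_{(U,Y)})\big]\qquad\forall\,\theta_{(U,Y)}\in\mathcal{H}_{(U,Y)}\overline{\mathcal{M}}^{q_3}_r.$$ Finally (at such a point), $\overline{\operatorname{Hess}h_r([U,Y])}$ has $(p_1+p_2-r)r$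 eigenvalues, and for $i=1,\dots,(p_1+p_2-r)r$, $\lambda_i(\overline{\operatorname{Hess}h_r([U,Y])})$ is sandwiched between $$\big(\sigma_r(W_Y^{-1})\wedge\sigma_r^2(YV_Y^{-1/2})\big)\lambda_i(\operatorname{Hess}f(X))\quad\text{and}\quad\big(\sigma_1(W_Y^{-1})\vee\sigma_1^2(YV_Y^{-1/2})\big)\lambda_i(\operatorname{Hess}f(X)).$$
   Context: Notation: $\mathbb{R}^{p\times r}_*$ = full-column-rank $p\times r$ matrices; $\mathrm{St}(r,p)$ = $p\times r$ matrices with orthonormal columns; $\mathbb{O}_r$ = $r\times r$ orthogonal matrices; $\mathbb{S}_+(r)$ = $r\times r$ symmetric positive definite matrices; $U_\perp$ = orthonormal complement of $U$, $P_{U_\perp}=U_\perp U_\perp^\top$; $\dagger$ = Moore–Penrose inverse; $\sigma_i,\lambda_i$ = $i$-th largest singular value/eigenvalue; $a\wedge b=\min$, $a\vee b=\max$. ''$a$ is sandwiched between $b$ and $c$'' means $\min\{b,c\}\le a\le\max\{b,c\}$. Objective: $f:\mathbb{R}^{p_1\times p_2}\to\mathbb{R}$ is twice continuously differentiable. Embedded geometry: $\mathcal{M}^e_r=\{X\in\mathbb{R}^{p_1\times p_2}:\operatorname{rank}X=r\}$, an embedded submanifold of dimension $(p_1+p_2-r)r$ with the metric induced by the Euclidean inner product. $\operatorname{grad}f(X)$, $\operatorname{Hess}f(X)$ are the Riemannian gradient and Hessian of $f|_{\mathcal{M}^e_r}$. Quotient geometry $\mathcal{M}^{q_3}_r$: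 total space $\overline{\mathcal{M}}^{q_3}_r=\mathrm{St}(r,p_1)\times\mathbb{R}^{p_2\times r}_*$, equivalence classes $[U,Y]=\{(UO,YO):O\in\mathbb{O}_r\}$, $\mathcal{M}^{q_3}_r=\overline{\mathcal{M}}^{q_3}_r/\mathbb{O}_r$ with quotient map $\pi$. Tangent vectors are written $\theta_{(U,Y)}=[\theta_U^\top\ \ \theta_Y^\top]^\top$. The total space carries the Riemannian metric $\bar g^r_{(U,Y)}(\eta,\theta)=\operatorname{tr}(V_Y\eta_U^\top\theta_U)+\operatorname{tr}(W_Y\eta_Y^\top\theta_Y)$, with weights $V_Y,W_Y\in\mathbb{S}_+(r)$ depending smoothly on $Y$. The chosen horizontal space (complementary, not necessarily orthogonal, to the tangent space of the fiber) is $$\mathcal{H}_{(U,Y)}\overline{\mathcal{M}}^{q_3}_r=\{[\theta_U^\top\ \ \theta_Y^\top]^\top:\theta_U=U_\perp D,\ D\in\mathbb{R}^{(p_1-r)\times r},\ \theta_Y\in\mathbb{R}^{p_2\times r}\}.$$ The horizontal lift at $(U,Y)$ of a tangent vector $\theta_{[U,Y]}$ is the unique horizontal $\theta_{(U,Y)}$ with $\mathrm{D}\pi(U,Y)[\theta_{(U,Y)}]=\theta_{[U,Y]}$; the quotient metric is $g^r_{[U,Y]}(\eta_{[U,Y]},\theta_{[U,Y]})=\bar g^r_{(U,Y)}(\eta_{(U,Y)},\theta_{(U,Y)})$. $h_r([U,Y])=f(UY^\top)$. $\overline{\operatorname{grad}h_r([U,Y])}$ is the horizontal lift of the Riemannian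 gradient, and $\overline{\operatorname{Hess}h_r([U,Y])}[\theta_{(U,Y)},\eta_{(U,Y)}]=\operatorname{Hess}h_r([U,Y])[\theta_{[U,Y]},\eta_{[U,Y]}]$ is the bilinear form of the Riemannian Hessian, on the horizontal space; its eigenvalues are those of the corresponding self-adjoint operator on the horizontal space with inner product $\bar g^r_{(U,Y)}$. A Riemannian first-order stationary point is a point where the Riemannian gradient vanishes. The map $\mathcal{L}^r_{U,Y}:\mathcal{H}_{(U,Y)}\overline{\mathcal{M}}^{q_3}_r\to T_X\mathcal{M}^e_r$ is $\mathcal{L}^r_{U,Y}(\theta_{(U,Y)})=U\theta_Y^\top+\theta_UY^\top$. *)

(* Defs.v *)
From HB Require Import structures.
From mathcomp Require Import all_boot all_order all_algebra.
From mathcomp Require Import all_classical all_reals all_analysis.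
Set Implicit Arguments.
Unset Strict Implicit.
Unset Printing Implicit Defensive.
Import Order.TTheory GRing.Theory Num.Theory.
Import numFieldNormedType.Exports.
Local Open Scope classical_set_scope.
Local Open Scope ring_scope.

Section Matrices.
Variable R : realType.

Definition spd n (S : 'M[R]_n) : Prop :=
  S^T = S /\ forall v : 'cV[R]_n, v != 0 -> 0 < (v^T *m S *m v) 0 0.

Definition spd_sqrt n (S : 'M[R]_n) : 'M[R]_n :=
  xget 0 [set T | spd T /\ T *m T = S].

Definition stiefel p r : set 'M[R]_(p, r) := [set U | U^T *m U = 1%:M].

Definition orthogonal_group r : set 'M[R]_r := [set O | O^T *m O = 1%:M].

Definition full_col_rank p r : set 'M[R]_(p, r) := [set Y | \rank Y = r].

Definition perp p r (U : 'M[R]_(p, r)) : 'M[R]_(p, p - r) :=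
  xget 0 [set Q | Q^T *m Q = 1%:M /\ U^T *m Q = 0].

Definition proj_perp p r (U : 'M[R]_(p, r)) : 'M[R]_p := perp U *m (perp U)^T.

Definition moore_penrose m n (A : 'M[R]_(m, n)) : 'M[R]_(n, m) :=
  xget 0 [set B | [/\ A *m B *m A = A, B *m A *m B = B,
                      (A *m B)^T = A *m B & (B *m A)^T = B *m A]].

(* The roots of q with multiplicity in nonincreasing order, when q is monic and
   splits over R; [::] otherwise. *)
Definition sorted_roots (q : {poly R}) : seq R :=
  xget [::] [set s | sorted (fun a b => b <= a) s /\
                     q = \prod_(l <- s) ('X - l%:P)].

Definition singular_values m n (A : 'M[R]_(m, n)) : seq R :=
  [seq Num.sqrt l | l <- take (minn m n) (sorted_roots (char_poly (A^T *m A)))].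

(* Indices of eigenvalues and singular values start at 1. *)
Definition sigma (k : nat) m n (A : 'M[R]_(m, n)) : R :=
  nth 0 (singular_values A) k.-1.

Definition sandwiched (a b c : R) : Prop := Num.min b c <= a <= Num.max b c.

End Matrices.

Section OperatorSpectrum.
Variables (R : realType) (E : normedModType R).

Definition basis_of_set (S : set E) n (e : 'I_n -> E) : Prop :=
  (forall c : 'I_n -> R, \sum_i c i *: e i = 0 -> forall i, c i = 0) /\
  S = [set v | exists c : 'I_n -> R, v = \sum_i c i *: e i].

Definition op_char_poly (S : set E) (T : E -> E) : {poly R} :=
  xget 0 [set q | exists n (e : 'I_n -> E) (A : 'M[R]_n),
    [/\ basis_of_set S e,
        forall j, T (e j) = \sum_i A i j *: e i &
        q = char_poly A]].

Definition op_eigenvalues (S : set E) (T : E -> E) : seq R :=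
  sorted_roots (op_char_poly S T).

Definition lambda (k : nat) (S : set E) (T : E -> E) : R :=
  nth 0 (op_eigenvalues S T) k.-1.

End OperatorSpectrum.

Section Differentiability.
Variable R : realType.

(* Meant for open A and finite-dimensional V: iterated directional derivatives
   along fixed vectors are then the entries of the iterated differentials. *)
Fixpoint Ck_on (V W : normedModType R) (A : set V) (k : nat) (F : V -> W) : Prop :=
  match k with
  | 0 => forall x, A x -> {for x, continuous F}
  | k'.+1 => (forall x, A x -> differentiable F x) /\
             forall v : V, Ck_on A k' (fun x => 'D_v F x)
  end.

Definition smooth_on (V W : normedModType R) (A : set V) (F : V -> W) : Prop :=
  forall k, Ck_on A k F.

(* C^k on an embedded submanifold A: local C^k extensions exist. *)
Definition Ck_along (V W : normedModType R) (A : set V) (k : nat) (F : V -> W) : Prop :=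
  forall x, A x -> exists (B : set V) (G : V -> W),
    [/\ open B, B x, Ck_on B k G & forall y, A y -> B y -> F y = G y].

Definition curve_in (V : normedModType R) (A : set V) (x v : V) (c : R -> V) : Prop :=
  [/\ c 0 = x, \forall t \near (0 : R), A (c t),
      exists2 e : R, 0 < e & Ck_on (ball (0 : R) e) 1 c &
      is_derive (0 : R) (1 : R) c v].

Definition tangent (V : normedModType R) (A : set V) (x : V) : set V :=
  [set v | exists c, curve_in A x v c].

Definition dalong (V : normedModType R) (A : set V) (phi : V -> R) (x v : V) : R :=
  xget 0 [set d | exists2 c, curve_in A x v c &
                  is_derive (0 : R) (1 : R) (phi \o c) d].

End Differentiability.

(* A Riemannian manifold presented as total / act, where total is an embedded
   submanifold of E and act is a group of linear maps of E preserving total.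
   A tangent vector at the class [x] is represented by its lift in hor x, a
   complement in the tangent space of total at x of the tangent space of the
   fiber; metric x is the inner product on hor x. An embedded submanifold is the
   case act = {id}, hor x = full tangent space.
   The maps on E used below (functions, fields) matter only on total. *)
Record rmanifold (R : realType) (E : normedModType R) := RManifold {
  total : set E;
  act : set (E -> E);
  hor : E -> set E;
  metric : E -> E -> E -> R }.

Section Riemannian.
Variables (R : realType) (E : normedModType R) (M : rmanifold E).

(* Functions on total / act are the invariant functions on total. *)
Definition function_on k (phi : E -> R) : Prop :=
  Ck_along (total M) k phi /\
  forall x a, total M x -> act M a -> phi (a x) = phi x.

(* For linear a with pi \o a = pi and a @` hor x = hor (a x), the horizontal
   lifts of one tangent vector at x and a x correspond under a; so vector fields
   on total / act are the equivariant horizontal fields. *)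
Definition field_on k (eta : E -> E) : Prop :=
  [/\ Ck_along (total M) k eta,
      forall x, total M x -> hor M x (eta x) &
      forall x a, total M x -> act M a -> eta (a x) = a (eta x)].

Definition rgrad (phi : E -> R) (x : E) : E :=
  xget 0 [set w | hor M x w /\
    forall v, hor M x v -> metric M x w v = dalong (total M) phi x v].

(* nabla eta x v is the covariant derivative at x of the field eta along v.
   C^1 fields are included because the gradient of a C^2 function is only C^1;
   torsion-freeness is stated through the action of [xi, eta] on functions. *)
Record levi_civita (nabla : (E -> E) -> E -> E -> E) : Prop := LeviCivita {
  lc_hor : forall eta x v, field_on 1 eta -> total M x -> hor M x v ->
    hor M x (nabla eta x v);
  lc_equivariant : forall eta x v a, field_on 1 eta -> total M x -> hor M x v ->
    act M a -> nabla eta (a x) (a v) = a (nabla eta x v);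
  lc_linear : forall eta x (s : R) u v, field_on 1 eta -> total M x ->
    hor M x u -> hor M x v ->
    nabla eta x (s *: u + v) = s *: nabla eta x u + nabla eta x v;
  lc_additive : forall eta zeta x v, field_on 1 eta -> field_on 1 zeta ->
    total M x -> hor M x v ->
    nabla (fun y => eta y + zeta y) x v = nabla eta x v + nabla zeta x v;
  lc_leibniz : forall phi eta x v, function_on 1 phi -> field_on 1 eta ->
    total M x -> hor M x v ->
    nabla (fun y => phi y *: eta y) x v =
    dalong (total M) phi x v *: eta x + phi x *: nabla eta x v;
  lc_metric : forall eta zeta x v, field_on 1 eta -> field_on 1 zeta ->
    total M x -> hor M x v ->
    dalong (total M) (fun y => metric M y (eta y) (zeta y)) x v =
    metric M x (nabla eta x v) (zeta x) + metric M x (eta x) (nabla zeta x v);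
  lc_torsion_free : forall xi eta phi x, field_on 1 xi -> field_on 1 eta ->
    function_on 2 phi -> total M x ->
    dalong (total M) phi x (nabla eta x (xi x) - nabla xi x (eta x)) =
    dalong (total M) (fun y => dalong (total M) phi y (eta y)) x (xi x) -
    dalong (total M) (fun y => dalong (total M) phi y (xi y)) x (eta x) }.

Definition rhess (nabla : (E -> E) -> E -> E -> E) (phi : E -> R) (x v : E) : E :=
  nabla (rgrad phi) x v.

Definition rhess_form (nabla : (E -> E) -> E -> E -> E) (phi : E -> R)
    (x v w : E) : R :=
  metric M x (rhess nabla phi x v) w.

End Riemannian.

Section FixedRank.
Variables (R : realType) (p1 p2 r : nat).

Definition rank_r_matrices : set 'M[R]_(p1, p2) := [set X | \rank X = r].

Definition Me : rmanifold 'M[R]_(p1, p2) :=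
  RManifold rank_r_matrices [set id] (tangent rank_r_matrices)
            (fun _ A B => \tr (A^T *m B)).

Definition factors : normedModType R := ('M[R]_(p1, r) * 'M[R]_(p2, r))%type.

Definition Mq3_total : set factors :=
  [set x | stiefel x.1 /\ full_col_rank x.2].

Definition Mq3_act : set (factors -> factors) :=
  [set a | exists2 O : 'M[R]_r, orthogonal_group O &
           a = fun x => (x.1 *m O, x.2 *m O)].

Definition Mq3_hor (x : factors) : set factors :=
  [set th | exists D : 'M[R]_(p1 - r, r), th.1 = perp x.1 *m D].

Definition Mq3_metric (V W : 'M[R]_(p2, r) -> 'M[R]_r) (x eta th : factors) : R :=
  \tr (V x.2 *m eta.1^T *m th.1) + \tr (W x.2 *m eta.2^T *m th.2).

Definition Mq3 (V W : 'M[R]_(p2, r) -> 'M[R]_r) : rmanifold factors :=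
  RManifold Mq3_total Mq3_act Mq3_hor (Mq3_metric V W).

Definition hr (f : 'M[R]_(p1, p2) -> R) (x : factors) : R := f (x.1 *m x.2^T).

Definition Lmap (U : 'M[R]_(p1, r)) (Y : 'M[R]_(p2, r)) (th : factors) :
    'M[R]_(p1, p2) :=
  U *m th.2^T + th.1 *m Y^T.

End FixedRank.
Arguments Me {R p1 p2} r.
Arguments Mq3 {R} p1 {p2 r} V W.

(* Main.v *)
(** Where the gradient field vanishes, compatibility with the metric reduces the
    Hessian form at [(v, w)] to the derivative along [v] of the gradient paired
    with any C^1 field through [w]; polynomial fields extend every tangent vector
    (for the quotient, equivariantly).  Differentiating the pairing on both sides,
    all terms tangent to the fixed-rank manifold are killed by the Euclidean
    gradient and the two Hessian forms agree through [Lmap].  Symmetry of the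
    Hessian of [f] follows from torsion-freeness alone.  Pulled back to
    coordinates, the two Hessian operators are thus pencils with the same symmetric
    form and two Gram matrices, whose ratio is controlled by [sigma]; the sandwich
    of eigenvalues is then Courant-Fischer.  Tangent spaces are computed from the
    identity [C = C B (A C B)^-1 A C], valid for [C] of rank [r] with [A C B]
    invertible of size [r]. *)

Require Import Defs.
From HB Require Import structures.
From mathcomp Require Import all_boot all_order all_algebra.
From mathcomp Require Import perm sesquilinear spectral complex.
From mathcomp Require Import all_classical all_reals all_analysis.
From mathcomp Require Import lra.
Set Implicit Arguments.
Unset Strict Implicit.
Unset Printing Implicit Defensive.
Import Order.TTheory GRing.Theory Num.Theory.
Import numFieldNormedType.Exports.
Local Open Scope classical_set_scope.
Local Open Scope ring_scope.

(** * Real symmetric matrices *)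

(** Almost every object of the statement is selected by [xget]: gradients, derivatives along a
    manifold, [perp], pseudo-inverses, square roots, characteristic polynomials, lists of roots.
    Each is usable only once existence, and often uniqueness, is known, so explicit formulas precede
    any reasoning about them. The connections are arbitrary solutions of the Levi-Civita axioms,
    which speak only of C^1 fields. Hence both gradients must be shown to be such fields; on the
    quotient this includes equivariance, where the transformation law of the weights enters. The
    weights leave the Hessian form because the gradient paired with a field is the differential of
    [hr f], in which no metric occurs; the rest agrees on both sides since stationarity means
    [G^T U = 0] and [G Y = 0] for the Euclidean gradient [G]. The weights return in the Gram matrix:
    [Lmap] splits the squared norm of a horizontal vector into a [th.1] part weighted by [Y^T Y] and
    an unweighted [th.2] part. Comparing each with its own term of the metric gives one singular
    value bound per block, whence the minimum and the maximum. *)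

Section LinearAlgebra.
Variable R : rcfType.

Lemma mxtrace_trmul m n (A B : 'M[R]_(m, n)) :
  \tr (A^T *m B) = \sum_i \sum_j A i j * B i j.
Proof.
rewrite /mxtrace exchange_big; apply: eq_bigr => j _.
by rewrite mxE; apply: eq_bigr => i _; rewrite mxE.
Qed.

Lemma mxtrace_trmulC m n (A B : 'M[R]_(m, n)) : \tr (A^T *m B) = \tr (B^T *m A).
Proof. by rewrite -mxtrace_tr trmx_mul trmxK. Qed.

Lemma mxtrace_trmul_ge0 m n (A : 'M[R]_(m, n)) : 0 <= \tr (A^T *m A).
Proof.
rewrite mxtrace_trmul; do 2!apply: sumr_ge0 => ? _.
by rewrite -expr2 sqr_ge0.
Qed.

Lemma mxtrace_trmul_eq0 m n (A : 'M[R]_(m, n)) : \tr (A^T *m A) = 0 -> A = 0.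
Proof.
rewrite mxtrace_trmul => /eqP; rewrite psumr_eq0; last first.
  by move=> i _; apply: sumr_ge0 => j _; rewrite -expr2 sqr_ge0.
move=> /allP A0; apply/matrixP => i j; rewrite mxE.
have := A0 i (mem_index_enum i); rewrite psumr_eq0; last first.
  by move=> k _; rewrite -expr2 sqr_ge0.
by move=> /allP /(_ j (mem_index_enum j)); rewrite mulf_eq0 orbb => /eqP.
Qed.

Lemma trmul_eq0 m n (A : 'M[R]_(m, n)) : A^T *m A = 0 -> A = 0.
Proof. by move=> A0; apply: mxtrace_trmul_eq0; rewrite A0 mxtrace0. Qed.

Lemma mxtrace_trmul_gt0 m n (A : 'M[R]_(m, n)) : A != 0 -> 0 < \tr (A^T *m A).
Proof.
move=> A0; rewrite lt_neqAle mxtrace_trmul_ge0 andbT eq_sym.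
by apply: contra_neq A0; exact: mxtrace_trmul_eq0.
Qed.

Lemma mxtrace11 (A : 'M[R]_1) : \tr A = A 0 0.
Proof. by rewrite /mxtrace big_ord1. Qed.

(** Over [complex R] the matrix is Hermitian, so the spectral theorem provides a real eigenvalue.
    Being a root of the characteristic polynomial descends to [R], and there it yields a real
    eigenvector. *)
Lemma symmetric_eigenvector n (S : 'M[R]_n.+1) : S^T = S ->
  exists (a : R) (v : 'rV[R]_n.+1), v != 0 /\ v *m S = a *: v.
Proof.
move=> S_sym; pose C : numClosedFieldType := complex R.
pose iota : {rmorphism R -> C} := real_complex R.
pose SC : 'M[C]_n.+1 := map_mx iota S.
have SC_real : SC \is a mxOver Num.real.
  by apply/mxOverP => i j; rewrite mxE; apply/complex_realP; exists (S i j).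
have SC_herm : SC \is hermitianmx _ false Num.conj.
  apply: realsym_hermsym => //.
  apply/is_hermitianmxP.
  rewrite expr0 scale1r map_mx_id //.
  by rewrite /SC map_trmx S_sym.
set P := spectralmx SC; set sp := spectral_diag SC.
have P_unit : P \in unitmx by exact: spectral_unit.
have SC_eq : SC = invmx P *m diag_mx sp *m P.
  exact/orthomx_spectralP/hermitian_normalmx.
have := hermitian_spectral_diag_real SC_herm.
move=> /mxOverP /(_ 0 0) /complex_realP[a sp_a].
have : eigenvalue SC (iota a).
  apply/eigenvalueP; exists (row 0 P).
    rewrite SC_eq rowE !mulmxA mulmxK // -[_ *m diag_mx sp]rowE row_diag_mx -scalemxAl.
    by rewrite -rowE; congr (_ *: _).
  apply: contraTneq P_unit => P0; rewrite unitmxE (expand_det_row _ 0).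
  rewrite big1 ?unitr0 // => j _; have /matrixP/(_ 0 j) := P0.
  by rewrite !mxE => ->; rewrite mul0r.
rewrite eigenvalue_root_char -map_char_poly fmorph_root -eigenvalue_root_char.
by move=> /eigenvalueP[v vS v0]; exists a, v.
Qed.

Lemma unit_normal_vector p k (Q : 'M[R]_(p, k)) : (k < p)%N ->
  exists u : 'cV[R]_p, u^T *m u = 1%:M /\ Q^T *m u = 0.
Proof.
move=> ltkp; have [w [wQ w0]] : exists w : 'rV[R]_p, w *m Q = 0 /\ w != 0.
  have /rowV0Pn[w /sub_kermxP wQ w0] : kermx Q != 0; last by exists w.
  rewrite -mxrank_eq0 mxrank_ker subn_eq0 -ltnNge.
  by rewrite (leq_ltn_trans _ ltkp) // rank_leq_col.
have ww : 0 < \tr (w *m w^T).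
  by have := @mxtrace_trmul_gt0 _ _ (w^T); rewrite trmxK trmx_eq0; exact.
exists ((Num.sqrt (\tr (w *m w^T)))^-1 *: w^T); split.
  rewrite [_^T]linearZ /= trmxK -scalemxAl -scalemxAr scalerA -invfM -expr2.
  rewrite sqr_sqrtr ?ltW // [X in _ *: X]mx11_scalar -mxtrace11.
  by rewrite scale_scalar_mx mulVf // gt_eqF.
by rewrite -scalemxAr -trmx_mul wQ trmx0 scaler0.
Qed.

(** Induction on [m]: append one unit normal vector to [Q] and complete the longer family. This is
    also what makes [perp] meaningful. *)
Lemma orthonormal_completion m p k (Q : 'M[R]_(p, k)) : (k + m <= p)%N ->
  Q^T *m Q = 1%:M ->
  exists Q' : 'M[R]_(p, m), Q'^T *m Q' = 1%:M /\ Q^T *m Q' = 0.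
Proof.
elim: m k Q => [|m IHm] k Q lekp QQ.
  by exists 0; rewrite !mulmx0 [RHS]flatmx0.
have [u [uu Qu]] : exists u : 'cV[R]_p, u^T *m u = 1%:M /\ Q^T *m u = 0.
  by apply: unit_normal_vector; rewrite (leq_trans _ lekp) // addnS ltnS leq_addr.
have [||Q' [QQ' Q'orth]] := IHm (k + 1)%N (row_mx Q u).
- by rewrite -addnA add1n.
- rewrite tr_row_mx mul_col_row QQ uu Qu.
  by rewrite -[u^T *m Q]trmxK trmx_mul trmxK Qu trmx0 -scalar_mx_block.
move: Q'orth; rewrite tr_row_mx mul_col_mx -col_mx0 => /eq_col_mx[QQ0 uQ0].
rewrite -[m.+1]add1n; exists (row_mx u Q'); split.
  rewrite tr_row_mx mul_col_row uu QQ' uQ0.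
  by rewrite -[Q'^T *m u]trmxK trmx_mul trmxK uQ0 trmx0 -scalar_mx_block.
by rewrite mul_mx_row Qu QQ0 row_mx0.
Qed.

(** Deflation: the orthogonal complement of a unit eigenvector [u] is stable under [S], so the
    induction hypothesis applies to the compression of [S] to it. *)
Lemma symmetric_diagonalization n (S : 'M[R]_n) : S^T = S ->
  exists (Q : 'M[R]_n) (d : 'rV[R]_n), Q^T *m Q = 1%:M /\ S = Q *m diag_mx d *m Q^T.
Proof.
elim: n S => [|n IHn] S.
  by exists 0, 0; split; apply/matrixP => -[].
move: S; rewrite -[n.+1]add1n => S S_sym.
have [a [v [v0 vS]]] := symmetric_eigenvector S_sym.
pose u0 : 'cV[R]_(1 + n) := v^T.
have u00 : u0 != 0 by rewrite trmx_eq0.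
have Su0 : S *m u0 = a *: u0 by rewrite -{1}S_sym -trmx_mul vS linearZ.
have uu0 : 0 < \tr (u0^T *m u0) by rewrite mxtrace_trmul_gt0.
pose u : 'cV[R]_(1 + n) := (Num.sqrt (\tr (u0^T *m u0)))^-1 *: u0.
have uu : u^T *m u = 1%:M.
  rewrite [_^T]linearZ /= -scalemxAl -scalemxAr scalerA -invfM -expr2.
  rewrite sqr_sqrtr ?ltW // [X in _ *: X]mx11_scalar -mxtrace11.
  by rewrite scale_scalar_mx mulVf // gt_eqF.
have Su : S *m u = a *: u by rewrite -scalemxAr Su0 !scalerA mulrC.
have [//|Q' [QQ' uQ']] := @orthonormal_completion n _ _ u _ uu.
have Q'u : Q'^T *m u = 0 by rewrite -[LHS]trmxK trmx_mul trmxK uQ' trmx0.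
have [|Q'' [d [QQ'' SQ'']]] := IHn (Q'^T *m S *m Q').
  by rewrite !trmx_mul trmxK S_sym mulmxA.
have uS : u^T *m S = a *: u^T by rewrite -{1}S_sym -trmx_mul Su linearZ.
pose M : 'M[R]_(1 + n) := row_mx u Q'.
have MM : M^T *m M = 1%:M.
  by rewrite tr_row_mx mul_col_row uu QQ' uQ' Q'u -scalar_mx_block.
exists (row_mx u (Q' *m Q'') : 'M[R]_(1 + n)), (row_mx a%:M d : 'rV[R]_(1 + n)); split.
  rewrite tr_row_mx mul_col_row uu mulmxA uQ' mul0mx !trmx_mul -!mulmxA Q'u mulmx0.
  by rewrite [Q'^T *m _]mulmxA QQ' mul1mx QQ'' -scalar_mx_block.
have /(mulmx1C (n := 1 + n)) MMT := MM.
(* The identity, written [u u^T + Q' Q'^T], is inserted on both sides of [S]; the mixed blocks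
   vanish because [u] is an eigenvector. *)
rewrite -[S]mul1mx -[_ *m S]mulmx1 -MMT.
rewrite /M tr_row_mx mul_row_col !mulmxDl !mulmxDr.
rewrite -!mulmxA.
have -> : S *m (u *m u^T) = a *: (u *m u^T) by rewrite mulmxA Su scalemxAl.
have -> : u^T *m (S *m (Q' *m Q'^T)) = 0.
  by rewrite !mulmxA uS -!scalemxAl uQ' mul0mx scaler0.
have -> : Q'^T *m (a *: (u *m u^T)) = 0.
  by rewrite -scalemxAr mulmxA Q'u mul0mx scaler0.
have -> : Q'^T *m (S *m (Q' *m Q'^T)) = Q'' *m diag_mx d *m Q''^T *m Q'^T.
  by rewrite !mulmxA SQ''.
rewrite diag_mx_row tr_row_mx mul_block_col mul_row_col !mul0mx !mulmx0.
rewrite !addr0 !add0r -scalemxAr [u^T *m _]mulmxA uu mul1mx.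
have -> : diag_mx a%:M = a%:M :> 'M[R]_1.
  by apply/matrixP => i j; rewrite !ord1 !mxE.
by rewrite mul_scalar_mx trmx_mul !mulmxA.
Qed.

Lemma symmetric_diagonalization_sorted n (S : 'M[R]_n) : S^T = S ->
  exists (Q : 'M[R]_n) (s : seq R),
  [/\ size s = n, sorted (fun a b => b <= a) s, Q^T *m Q = 1%:M &
      S = Q *m diag_mx (\row_i s`_i) *m Q^T].
Proof.
move=> /symmetric_diagonalization[Q [d [QQ ->]]].
pose t := [tuple d 0 i | i < n].
pose ge := fun a b : R => b <= a.
have [s s_sorted ts] : exists2 s : n.-tuple R, sorted ge s & perm_eq t s.
  exists (sort_tuple ge t); first by apply: sort_sorted => a b; exact: le_total.
  by rewrite perm_sym perm_sort.
have /tuple_permP[p sp] : perm_eq s t by rewrite perm_sym ts.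
have sE (i : 'I_n) : s`_i = d 0 (p i).
  have /val_inj/(congr1 (fun z : n.-tuple R => tnth z i)) := sp.
  by rewrite -tnth_nth => ->; rewrite !tnth_mktuple.
exists (col_perm p Q), s; split => //; first by rewrite size_tuple.
  apply/matrixP => i j; rewrite mxE; have /matrixP/(_ (p i) (p j)) := QQ.
  rewrite !mxE (inj_eq perm_inj) => <-; apply: eq_bigr => k _.
  by rewrite !mxE.
apply/matrixP => i j; rewrite !mul_mx_diag !mxE (reindex_inj (@perm_inj _ p)) /=.
by apply: eq_bigr => k _; rewrite !mxE sE.
Qed.

Lemma prod_XsubC_sorted_inj (s t : seq R) :
  sorted (fun a b => b <= a) s -> sorted (fun a b => b <= a) t ->
  \prod_(l <- s) ('X - l%:P) = \prod_(l <- t) ('X - l%:P) -> s = t.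
Proof.
move=> s_sorted t_sorted /prod_XsubC_eq; apply: sorted_eq s_sorted t_sorted.
  by move=> b a c ba cb; exact: le_trans cb ba.
by move=> a b /andP[ba ab]; apply/le_anti/andP.
Qed.
Lemma sorted_ge_nth (s : seq R) i j : sorted (fun a b => b <= a) s ->
  (i <= j)%N -> (j < size s)%N -> s`_j <= s`_i.
Proof.
move=> s_sorted leij ltjs.
apply: (sorted_leq_nth (leT := fun a b : R => b <= a)) => //.
  by move=> b a c ba cb; exact: le_trans cb ba.
by rewrite inE (leq_ltn_trans leij).
Qed.

End LinearAlgebra.

(** * Characteristic polynomials and eigenvalues of symmetric pencils *)

Section Spectra.
Variable R : realType.

Lemma sorted_rootsE (s : seq R) : sorted (fun a b => b <= a) s ->
  sorted_roots (\prod_(l <- s) ('X - l%:P)) = s.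
Proof.
move=> s_sorted; apply: xget_subset1 => // t u [t_sorted tE] [u_sorted uE].
by apply: prod_XsubC_sorted_inj => //; rewrite -tE.
Qed.

(** After multiplication by [\det P], a nonzero constant polynomial, both sides become determinants
    of the same product. *)
Lemma char_poly_intertwine n (P A B : 'M[R]_n) : P \in unitmx ->
  A *m P = P *m B -> char_poly A = char_poly B.
Proof.
move=> Pu AP; rewrite /char_poly.
have PP : \det (map_mx polyC P) != 0.
  by rewrite det_map_mx polyC_eq0 -unitfE -unitmxE.
apply: (mulIf PP); rewrite -det_mulmx mulrC -det_mulmx; congr (\det _).
rewrite /char_poly_mx mulmxBl mulmxBr -!map_mxM /= AP.
by rewrite -scalar_mxC.
Qed.

Lemma char_poly_diag_seq n (s : seq R) : size s = n ->
  char_poly (diag_mx (\row_(i < n) s`_i)) = \prod_(l <- s) ('X - l%:P).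
Proof.
move=> sn; rewrite char_poly_trig ?diag_mx_is_trig // (big_nth 0) sn big_mkord.
by apply: eq_bigr => i _; rewrite !mxE eqxx.
Qed.

(** The rows of [P] form a basis in which the form [B] is diagonal, and each row of [E] is a
    coordinate vector in it; the trace sums the form over these rows. *)
Lemma qform_gram (m n : nat) (B P : 'M[R]_n) (d : 'rV[R]_n) (E : 'M[R]_(m, n)) :
  P *m B *m P^T = diag_mx d ->
  \tr ((E *m P) *m B *m (E *m P)^T) = \sum_i \sum_j d 0 j * E i j ^+ 2.
Proof.
move=> PB; rewrite trmx_mul -!mulmxA [B *m _]mulmxA [P *m _]mulmxA [P *m _]mulmxA PB.
rewrite mulmxA; apply: eq_bigr => i _; rewrite mxE; apply: eq_bigr => j _.
by rewrite mul_mx_diag !mxE expr2 mulrAC mulrC mulrA.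
Qed.

Lemma spectral_coef_gt0 n (S Q : 'M[R]_n) (d : 'rV[R]_n) : spd S ->
  Q^T *m Q = 1%:M -> S = Q *m diag_mx d *m Q^T -> forall i, 0 < d 0 i.
Proof.
move=> [_ S_pos] QQ SE i.
have /S_pos : col i Q != 0.
  apply/eqP => Qi; have /matrixP/(_ i i) := QQ.
  rewrite !mxE eqxx => /esym/eqP; rewrite big1 ?oner_eq0 // => k _.
  have /matrixP/(_ k 0) := Qi.
  by rewrite !mxE => ->; rewrite mulr0.
rewrite SE colE trmx_mul !mulmxA -[_ *m Q^T *m Q]mulmxA QQ mulmx1.
rewrite -[_ *m Q^T *m Q]mulmxA QQ mulmx1 trmx_delta -rowE -colE !mxE eqxx.
by rewrite mulr1n.
Qed.

(** Simultaneous diagonalization by congruence: [P0] turns [G] into the identity, and a rotation,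
    which preserves the identity, then diagonalizes the transformed [H]. The list [s] holds the
    generalized eigenvalues of [H] relative to [G]. *)
Lemma spd_pencil n (G H : 'M[R]_n) : spd G -> H^T = H ->
  exists (P : 'M[R]_n) (s : seq R),
  [/\ size s = n, sorted (fun a b => b <= a) s,
      P \in unitmx,
      P *m G *m P^T = 1%:M /\ P *m H *m P^T = diag_mx (\row_i s`_i) &
      char_poly (invmx G *m H) = \prod_(l <- s) ('X - l%:P)].
Proof.
move=> [G_sym G_pos] H_sym.
have [Q [d [QQ GE]]] := symmetric_diagonalization G_sym.
have QQT : Q *m Q^T = 1%:M by apply: mulmx1C.
have d_gt0 := spectral_coef_gt0 (conj G_sym G_pos) QQ GE.
pose P0 : 'M[R]_n := diag_mx (\row_i (Num.sqrt (d 0 i))^-1) *m Q^T.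
have P0G : P0 *m G *m P0^T = 1%:M.
  rewrite GE /P0 trmx_mul trmxK tr_diag_mx !mulmxA.
  rewrite -[_ *m Q^T *m Q]mulmxA QQ mulmx1 -[_ *m Q^T *m Q]mulmxA QQ mulmx1.
  rewrite !mulmx_diag -diag_const_mx; congr diag_mx; apply/rowP => i; rewrite !mxE.
  by rewrite mulrAC -invfM -expr2 sqr_sqrtr ?ltW // mulVf // gt_eqF.
clearbody P0.
have [|Q1 [s [s_n s_sorted Q1Q1 HE]]] :=
  @symmetric_diagonalization_sorted _ _ (P0 *m H *m P0^T).
  by rewrite !trmx_mul trmxK H_sym mulmxA.
pose P := Q1^T *m P0; exists P, s.
have PE X : P *m X *m P^T = Q1^T *m (P0 *m X *m P0^T) *m Q1.
  by rewrite trmx_mul trmxK !mulmxA.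
have PG : P *m G *m P^T = 1%:M by rewrite PE P0G mulmx1.
have PH : P *m H *m P^T = diag_mx (\row_i s`_i).
  by rewrite PE HE !mulmxA Q1Q1 mul1mx -mulmxA Q1Q1 mulmx1.
have Pu : P \in unitmx by have := PG; rewrite -mulmxA => /mulmx1_unit[].
have Gu : G \in unitmx.
  by have /mulmx1C := PG; rewrite mulmxA => /mulmx1_unit[].
split => //; rewrite -(char_poly_diag_seq s_n) -PH.
(* From [P G P^T = 1] follows [invmx G = P^T P], so [P^T] intertwines [invmx G *m H] with the
   diagonal matrix. *)
apply: (@char_poly_intertwine _ P^T); first by rewrite unitmx_tr.
have -> : invmx G = P^T *m P.
  apply: (can_inj (mulKmx Gu)); rewrite mulmxV // mulmxA.
  by apply/esym/mulmx1C; rewrite -PG mulmxA.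
by rewrite !mulmxA.
Qed.

(* The Courant-Fischer argument: the span of the first [i+1] eigenvectors of one
   pencil meets the span of the last [n-i] eigenvectors of the other one. *)
Lemma pencils_common_vector n (G1 G2 H P1 P2 : 'M[R]_n) (s1 s2 : seq R) i :
  size s1 = n -> size s2 = n ->
  sorted (fun a b => b <= a) s1 -> sorted (fun a b => b <= a) s2 ->
  P1 \in unitmx -> P2 \in unitmx ->
  P1 *m G1 *m P1^T = 1%:M -> P1 *m H *m P1^T = diag_mx (\row_j s1`_j) ->
  P2 *m G2 *m P2^T = 1%:M -> P2 *m H *m P2^T = diag_mx (\row_j s2`_j) ->
  (i < n)%N ->
  exists w : 'rV[R]_n, [/\ w != 0,
    s1`_i * \tr (w *m G1 *m w^T) <= \tr (w *m H *m w^T) &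
    \tr (w *m H *m w^T) <= s2`_i * \tr (w *m G2 *m w^T)].
Proof.
move=> s1n s2n s1_sorted s2_sorted P1u P2u P1G P1H P2G P2H ltin.
pose A1 : 'M[R]_n := pid_mx i.+1 *m P1; pose A2 : 'M[R]_n := copid_mx i *m P2.
have [w [w0 wA1 wA2]] : exists w : 'rV[R]_n, [/\ w != 0, (w <= A1)%MS & (w <= A2)%MS].
  have : (A1 :&: A2)%MS != 0.
    rewrite -mxrank_eq0 -lt0n.
    have rA1 : \rank A1 = i.+1 by rewrite mxrankMfree ?row_free_unit // rank_pid_mx.
    have rA2 : \rank A2 = (n - i)%N.
      by rewrite mxrankMfree ?row_free_unit // rank_copid_mx // ltnW.
    have := mxrank_sum_cap A1 A2; rewrite rA1 rA2 addSn subnKC ?(ltnW ltin) //.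
    have := rank_leq_col (A1 + A2)%MS.
    case: (\rank (_ :&: _)) => // le_n; rewrite addn0 => eq_n; move: le_n.
    by rewrite eq_n ltnn.
  by case/rowV0Pn=> w; rewrite sub_capmx => /andP[? ?] ?; exists w.
exists w; split => //.
  case/submxP: wA1 => a; rewrite mulmxA => ->.
  rewrite (qform_gram _ P1H) (@qform_gram _ _ G1 _ (const_mx 1)) ?diag_const_mx //.
  rewrite mulr_sumr; apply: ler_sum => j _; rewrite mulr_sumr; apply: ler_sum => k _.
  rewrite !mxE mul1r; have [leki|ltik] := leqP k i.
    by apply: ler_wpM2r; rewrite ?sqr_ge0 // sorted_ge_nth ?s1n ?s2n.
  rewrite big1 ?expr0n ?mulr0 // => l _; rewrite !mxE.
  by case: eqP => [->|_]; rewrite ?mulr0 //= ltnS leqNgt ltik mulr0.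
case/submxP: wA2 => a; rewrite mulmxA => ->.
rewrite (qform_gram _ P2H) (@qform_gram _ _ G2 _ (const_mx 1)) ?diag_const_mx //.
rewrite mulr_sumr; apply: ler_sum => j _; rewrite mulr_sumr; apply: ler_sum => k _.
rewrite !mxE mul1r; have [leik|ltki] := leqP i k.
  by apply: ler_wpM2r; rewrite ?sqr_ge0 // sorted_ge_nth ?s1n ?s2n.
rewrite big1 ?expr0n ?mulr0 // => l _; rewrite !mxE.
case: eqP => [->|]; last first.
  by move=> /eqP; rewrite (inj_eq val_inj) => /negPf ->; rewrite subr0 mulr0.
by rewrite eqxx ltki subrr mulr0.
Qed.

(** A common vector of the two pencils compares [l1] times the [G1] norm with [l2] times the [G2]
    norm. The sign of [l2] decides which of the bounds [a], [b] on the ratio of the norms applies,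
    whence the minimum and the maximum. *)
Lemma pencils_sandwich n (G1 G2 H : 'M[R]_n) (a b : R) i :
  spd G1 -> spd G2 -> H^T = H -> (i < n)%N ->
  (forall w : 'rV[R]_n, a * \tr (w *m G1 *m w^T) <= \tr (w *m G2 *m w^T) <=
                        b * \tr (w *m G1 *m w^T)) ->
  let l1 := (sorted_roots (char_poly (invmx G1 *m H)))`_i in
  let l2 := (sorted_roots (char_poly (invmx G2 *m H)))`_i in
  Num.min (a * l2) (b * l2) <= l1 <= Num.max (a * l2) (b * l2).
Proof.
move=> G1_spd G2_spd H_sym ltin ab.
have [P1 [s1 [s1n s1_sorted P1u [P1G P1H] ->]]] := spd_pencil G1_spd H_sym.
have [P2 [s2 [s2n s2_sorted P2u [P2G P2H] ->]]] := spd_pencil G2_spd H_sym.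
rewrite !sorted_rootsE //=.
have G1_gt0 (w : 'rV[R]_n) : w != 0 -> 0 < \tr (w *m G1 *m w^T).
  move=> w0; have := G1_spd.2 (w^T); rewrite trmxK trmx_eq0 mxtrace11; exact.
apply/andP; split.
  have [w [/G1_gt0 w0 le2 le1]] :=
    pencils_common_vector s2n s1n s2_sorted s1_sorted P2u P1u P2G P2H P1G P1H ltin.
  have /andP[abl abr] := ab w; rewrite ge_min.
  have {le1} le12 := le_trans le2 le1.
  case: (leP 0 (s2`_i)) => s20; apply/orP; [left|right].
    rewrite -(ler_pM2r w0); apply: le_trans le12; rewrite [a * _]mulrC -mulrA.
    exact: ler_wpM2l.
  rewrite -(ler_pM2r w0); apply: le_trans le12; rewrite [b * _]mulrC -mulrA.
  by apply: ler_wnM2l => //; exact: ltW.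
have [w [/G1_gt0 w0 le1 le2]] :=
  pencils_common_vector s1n s2n s1_sorted s2_sorted P1u P2u P1G P1H P2G P2H ltin.
have /andP[abl abr] := ab w; rewrite le_max.
have {le1} le12 := le_trans le1 le2.
case: (leP 0 (s2`_i)) => s20; apply/orP; [right|left].
  rewrite -(ler_pM2r w0); apply: le_trans le12 _; rewrite [b * _]mulrC -mulrA.
  exact: ler_wpM2l.
rewrite -(ler_pM2r w0); apply: le_trans le12 _; rewrite [a * _]mulrC -mulrA.
by apply: ler_wnM2l => //; exact: ltW.
Qed.

End Spectra.

(** * Singular values and square roots of positive definite matrices *)

Section SingularValues.
Variable R : realType.

Lemma spd_unitmx n (S : 'M[R]_n) : spd S -> S \in unitmx.
Proof.
move=> S_spd; have [P [s [_ _ _ [PS _] _]]] := spd_pencil S_spd (trmx1 R n).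
by have /mulmx1C := PS; rewrite mulmxA => /mulmx1_unit[].
Qed.

Lemma rayleigh_bounds (m n : nat) (B Q : 'M[R]_n.+1) (s : seq R) (E : 'M[R]_(m, n.+1)) :
  size s = n.+1 -> sorted (fun a b => b <= a) s -> Q^T *m Q = 1%:M ->
  B = Q *m diag_mx (\row_i s`_i) *m Q^T ->
  s`_n * \tr (E *m E^T) <= \tr (E *m B *m E^T) <= s`_0 * \tr (E *m E^T).
Proof.
move=> sn s_sorted QQ BE.
have QQT : Q *m Q^T = 1%:M by apply: mulmx1C.
have EE : E = (E *m Q) *m Q^T by rewrite -mulmxA QQT mulmx1.
have trE : \tr (E *m E^T) = \sum_i \sum_j 1 * (E *m Q) i j ^+ 2.
  rewrite -{1}[E]mulmx1 {1 2}EE.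
  rewrite (@qform_gram _ _ _ _ _ (const_mx 1)); last by rewrite diag_const_mx mulmx1 trmxK.
  by do 2!apply: eq_bigr => ? _; rewrite mxE.
have trB : \tr (E *m B *m E^T) = \sum_i \sum_(j < n.+1) s`_j * (E *m Q) i j ^+ 2.
  rewrite {1 2}EE (@qform_gram _ _ _ _ _ (\row_(j < n.+1) s`_j)).
    by do 2!apply: eq_bigr => ? _; rewrite mxE.
  by rewrite trmxK BE !mulmxA QQ mul1mx -mulmxA QQ mulmx1.
rewrite trE trB; apply/andP; split.
  rewrite mulr_sumr; apply: ler_sum => i _; rewrite mulr_sumr; apply: ler_sum => j _.
  by rewrite mul1r; apply: ler_wpM2r; rewrite ?sqr_ge0 // sorted_ge_nth ?sn // -ltnS.
rewrite mulr_sumr; apply: ler_sum => i _; rewrite mulr_sumr; apply: ler_sum => j _.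
by rewrite mul1r; apply: ler_wpM2r; rewrite ?sqr_ge0 // sorted_ge_nth ?sn.
Qed.

Lemma char_poly_spectral n (Q : 'M[R]_n) (s : seq R) : size s = n ->
  Q^T *m Q = 1%:M ->
  char_poly (Q *m diag_mx (\row_i s`_i) *m Q^T) = \prod_(l <- s) ('X - l%:P).
Proof.
move=> sn QQ; rewrite -(char_poly_diag_seq sn).
have Qu : Q \in unitmx by have [] := mulmx1_unit QQ.
by apply: (char_poly_intertwine Qu); rewrite -mulmxA QQ mulmx1.
Qed.

(** As [n <= m], the truncation in [singular_values] drops nothing, and [sigma n], [sigma 1] are the
    square roots of the extreme eigenvalues of [A^T A]. *)
Lemma sigma_sqr_bounds (k m n : nat) (A : 'M[R]_(m, n)) (E : 'M[R]_(k, n)) :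
  (0 < n <= m)%N ->
  sigma n A ^+ 2 * \tr (E *m E^T) <= \tr (E *m (A^T *m A) *m E^T)
    <= sigma 1 A ^+ 2 * \tr (E *m E^T).
Proof.
case: n A E => // n A E /= lenm.
have [|Q [s [sn s_sorted QQ SE]]] := @symmetric_diagonalization_sorted _ _ (A^T *m A).
  by rewrite trmx_mul trmxK.
(* Each coefficient is the squared norm of [A] applied to a column of [Q]; nonnegativity makes
   [Num.sqrt] a genuine square root. *)
have s_ge0 i : (i < n.+1)%N -> 0 <= s`_i.
  move=> ltin; have := mxtrace_trmul_ge0 (A *m col (Ordinal ltin) Q).
  rewrite trmx_mul mulmxA -(mulmxA _ A^T) SE colE trmx_mul !mulmxA.
  rewrite -[_ *m Q^T *m Q]mulmxA QQ mulmx1 -[_ *m Q^T *m Q]mulmxA QQ mulmx1.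
  by rewrite trmx_delta -rowE -colE mxtrace11 !mxE eqxx mulr1n.
have sigmaE i : (i < n.+1)%N -> sigma i.+1 A ^+ 2 = s`_i.
  move=> ltin; rewrite /sigma /singular_values (minn_idPr lenm) SE.
  rewrite char_poly_spectral // sorted_rootsE // take_oversize ?sn //=.
  by rewrite (nth_map 0) ?sn // sqr_sqrtr ?s_ge0.
by rewrite !sigmaE //; exact: rayleigh_bounds QQ SE.
Qed.

(** The eigenvalues of [B^T B] are the squares of those of [B]; positivity keeps the squares in the
    same order, so singular values and eigenvalues of [B] coincide. *)
Lemma sigma_spd_bounds (k n : nat) (B : 'M[R]_n) (E : 'M[R]_(k, n)) :
  (0 < n)%N -> spd B ->
  sigma n B * \tr (E *m E^T) <= \tr (E *m B *m E^T) <= sigma 1 B * \tr (E *m E^T).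
Proof.
case: n B E => // n B E _ B_spd.
have [Q [s [sn s_sorted QQ BE]]] := symmetric_diagonalization_sorted B_spd.1.
have s_gt0 i : (i < n.+1)%N -> 0 < s`_i.
  by move=> ltin; have := spectral_coef_gt0 B_spd QQ BE (Ordinal ltin); rewrite mxE.
have s2_sorted : sorted (fun a b => b <= a) [seq l ^+ 2 | l <- s].
  apply/(sortedP 0) => i; rewrite size_map sn => ltin.
  rewrite !(nth_map 0) ?sn ?(ltnW ltin) //.
  have /(sortedP 0)/(_ i) := s_sorted; rewrite sn => /(_ ltin) le_s.
  by rewrite ler_sqr // nnegrE ltW // s_gt0 // ltnW.
have BB : B^T *m B = Q *m diag_mx (\row_i [seq l ^+ 2 | l <- s]`_i) *m Q^T.
  rewrite B_spd.1 BE -!mulmxA; congr (Q *m _); rewrite !mulmxA.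
  congr (_ *m _); rewrite -[_ *m Q^T *m Q]mulmxA QQ mulmx1 mulmx_diag.
  by congr diag_mx; apply/rowP => i; rewrite !mxE (nth_map 0) ?sn.
have sigmaE i : (i < n.+1)%N -> sigma i.+1 B = s`_i.
  move=> ltin; rewrite /sigma /singular_values minnn BB.
  rewrite char_poly_spectral ?size_map // sorted_rootsE //.
  rewrite take_oversize ?size_map ?sn //=.
  by rewrite !(nth_map 0) ?size_map ?sn // sqrtr_sqr ger0_norm // ltW // s_gt0.
by rewrite !sigmaE //; exact: rayleigh_bounds QQ BE.
Qed.

Lemma spd_spectral n (Q : 'M[R]_n) (d : 'rV[R]_n) : Q^T *m Q = 1%:M ->
  (forall i, 0 < d 0 i) -> spd (Q *m diag_mx d *m Q^T).
Proof.
move=> QQ d_gt0; split; first by rewrite !trmx_mul trmxK tr_diag_mx mulmxA.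
move=> v v0; have : Q^T *m v != 0.
  apply: contra_neq v0 => Qv; have := congr1 (mulmx Q) Qv.
  by rewrite mulmx0 mulmxA (mulmx1C QQ) mul1mx.
set w := Q^T *m v => w0.
have -> : v^T *m (Q *m diag_mx d *m Q^T) *m v = w^T *m diag_mx d *m w.
  by rewrite trmx_mul trmxK !mulmxA.
clearbody w; have /existsP[i wi] : [exists i, w i 0 != 0].
  apply: contraNT w0 => /existsPn w0; apply/eqP/colP => i.
  by have := w0 i; rewrite negbK mxE => /eqP.
rewrite mul_mx_diag mxE (bigD1 i) //= ltr_wpDr //.
  apply: sumr_ge0 => j _; rewrite !mxE mulrAC -expr2.
  by rewrite mulr_ge0 ?sqr_ge0 // ltW.
by rewrite !mxE mulrAC -expr2 mulr_gt0 // lt_neqAle eq_sym sqrf_eq0 wi sqr_ge0.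
Qed.

Lemma spd_sqrtP n (S : 'M[R]_n) : spd S ->
  spd (spd_sqrt S) /\ spd_sqrt S *m spd_sqrt S = S.
Proof.
move=> S_spd; suff : exists T, spd T /\ T *m T = S by exact: xgetPex.
have [Q [d [QQ SE]]] := symmetric_diagonalization S_spd.1.
have d_gt0 := spectral_coef_gt0 S_spd QQ SE.
exists (Q *m diag_mx (\row_i Num.sqrt (d 0 i)) *m Q^T); split.
  by apply: spd_spectral => // i; rewrite mxE sqrtr_gt0.
rewrite SE -!mulmxA; congr (Q *m _); rewrite !mulmxA; congr (_ *m _).
rewrite -[_ *m Q^T *m Q]mulmxA QQ mulmx1 mulmx_diag; congr diag_mx.
by apply/rowP => i; rewrite !mxE -expr2 sqr_sqrtr // ltW.
Qed.

Lemma spd_invmx n (S : 'M[R]_n) : spd S -> spd (invmx S).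
Proof.
move=> S_spd; have Su := spd_unitmx S_spd.
split; first by rewrite trmx_inv S_spd.1.
move=> v v0; have /S_spd.2 : invmx S *m v != 0.
  by apply: contra_neq v0 => /(congr1 (mulmx S)); rewrite mulKVmx // mulmx0.
by rewrite trmx_mul trmx_inv S_spd.1 !mulmxA mulmxKV.
Qed.

End SingularValues.

(** * Full column rank, pseudo-inverses and orthonormal complements *)

Section FullRank.
Variable R : realType.

(** A vector in the kernel of [Y^T Y] gives a combination of columns of [Y] of zero norm.
    Invertibility of the Gram matrix is the form of the rank condition that is visibly open in
    [Y]. *)
Lemma full_col_rank_unit p r (Y : 'M[R]_(p, r)) :
  full_col_rank Y <-> Y^T *m Y \in unitmx.
Proof.
split=> [Yr|Yu]; last first.
  apply/eqP; rewrite /= eqn_leq rank_leq_col /=.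
  by rewrite -{1}(mxrank_unit Yu) mxrankM_maxr.
rewrite -row_free_unit; apply: inj_row_free => v vYY.
have vY : v *m Y^T = 0.
  apply: (can_inj (@trmxK R _ _)); rewrite trmx0; apply: trmul_eq0.
  by rewrite trmxK trmx_mul trmxK mulmxA -(mulmxA v) vYY mul0mx.
have Yf : row_free Y^T by rewrite /row_free mxrank_tr Yr.
by apply: (row_free_inj Yf); rewrite vY mul0mx.
Qed.

Lemma moore_penrose_full_col_rank p r (Y : 'M[R]_(p, r)) : full_col_rank Y ->
  moore_penrose Y = invmx (Y^T *m Y) *m Y^T.
Proof.
move=> /full_col_rank_unit Yu; apply: xget_subset1.
  have YY : invmx (Y^T *m Y) *m Y^T *m Y = 1%:M by rewrite -mulmxA mulVmx.
  split; rewrite ?YY ?mul1mx ?trmx1 //; first by rewrite -mulmxA YY mulmx1.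
  by rewrite !trmx_mul trmx_inv trmx_mul trmxK mulmxA.
move=> B C [B1 B2 B3 B4] [C1 C2 C3 C4].
(* Penrose's uniqueness: [Y B] and [Y C] are symmetric projectors with the same range, [B Y] and
   [C Y] symmetric projectors with the same kernel. *)
have BC : Y *m B = Y *m C.
  have : Y *m B = Y *m C *m (Y *m B) by rewrite mulmxA C1.
  by move=> BE; rewrite -[LHS]B3 {1}BE trmx_mul B3 C3 mulmxA B1.
have CB : B *m Y = C *m Y.
  have : B *m Y = B *m Y *m (C *m Y) by rewrite -mulmxA [Y *m _]mulmxA C1.
  by move=> BE; rewrite -[LHS]B4 {1}BE trmx_mul B4 C4 -mulmxA [Y *m _]mulmxA B1.
by rewrite -[LHS]B2 -mulmxA BC mulmxA CB C2.
Qed.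

Lemma stiefel_leq p r (U : 'M[R]_(p, r)) : stiefel U -> (r <= p)%N.
Proof.
move=> /= UU; rewrite -(mxrank1 R r) -UU.
by rewrite (leq_trans (mxrankM_maxl _ _)) // rank_leq_col.
Qed.

Lemma perpP p r (U : 'M[R]_(p, r)) : stiefel U ->
  (perp U)^T *m perp U = 1%:M /\ U^T *m perp U = 0.
Proof.
move=> U_st; apply: (@xgetPex _ _ [set Q : 'M[R]_(p, p - r) |
  Q^T *m Q = 1%:M /\ U^T *m Q = 0]).
by apply: orthonormal_completion => //; rewrite subnKC // (stiefel_leq U_st).
Qed.

(** Serves [row_mx U (perp U)], whose [r + (p - r)] columns equal [p] only propositionally. *)
Lemma mulmx1C_eq (m n : nat) (A : 'M[R]_(m, n)) (B : 'M[R]_(n, m)) : m = n ->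
  A *m B = 1%:M -> B *m A = 1%:M.
Proof. by move=> mn; case: _ / mn in A B *; exact: mulmx1C. Qed.

(** The square matrix [row_mx U (perp U)] is orthogonal, and orthogonality on the other side is the
    claim. The right-hand side is free of the chosen complement and polynomial in [U], hence can be
    differentiated. *)
Lemma proj_perpE p r (U : 'M[R]_(p, r)) : stiefel U ->
  proj_perp U = 1%:M - U *m U^T.
Proof.
move=> U_st; have [QQ UQ] := perpP U_st; rewrite /proj_perp.
have QU : (perp U)^T *m U = 0 by rewrite -[LHS]trmxK trmx_mul trmxK UQ trmx0.
have : (row_mx U (perp U))^T *m row_mx U (perp U) = 1%:M.
  by rewrite tr_row_mx mul_col_row QQ UQ QU U_st -scalar_mx_block.
move=> /(mulmx1C_eq (subnKC (stiefel_leq U_st))).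
by rewrite tr_row_mx mul_row_col => <-; rewrite addrC addKr.
Qed.

(** Replaces the chosen complement by a linear equation, the form in which horizontality is tested
    below. *)
Lemma perp_rangeP p r (U : 'M[R]_(p, r)) q (A : 'M[R]_(p, q)) : stiefel U ->
  (exists D, A = perp U *m D) <-> U^T *m A = 0.
Proof.
move=> U_st; have [QQ UQ] := perpP U_st; split=> [[D ->]|UA].
  by rewrite mulmxA UQ mul0mx.
exists ((perp U)^T *m A); rewrite mulmxA -/(proj_perp U) proj_perpE // mulmxBl.
by rewrite -mulmxA UA mulmx0 mul1mx subr0.
Qed.

End FullRank.

(** * Spectra of self-adjoint operators *)

Section Operators.
Variable R : realType.

(** Independence of the basis: the transition matrices between two bases are mutually inverse, which
    forces equal sizes, and they intertwine the two matrices of [T]. *)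
Lemma op_char_polyE (E : normedModType R) (S : set E) (T : E -> E) n
    (e : 'I_n -> E) (A : 'M[R]_n) :
  (forall c u v, S u -> S v -> T (c *: u + v) = c *: T u + T v) ->
  basis_of_set S e -> (forall j, T (e j) = \sum_i A i j *: e i) ->
  op_char_poly S T = char_poly A.
Proof.
move=> T_lin e_basis TA; rewrite /op_char_poly.
(* Linearity is known on [S] only, so membership of the partial sums is carried along; padding the
   coefficients with zeros provides it. *)
have T_sum m (f : 'I_m -> E) c : (forall c, S (\sum_i c i *: f i)) ->
    T (\sum_i c i *: f i) = \sum_i c i *: T (f i).
  move=> Sf.
  have S0 : S 0 by have := Sf (fun=> 0); rewrite big1 // => i _; rewrite scale0r.
  have T0 : T 0 = 0.
    have := T_lin 1 0 0 S0 S0; rewrite !scale1r addr0 => /eqP.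
    by rewrite -subr_eq0 opprD addNKr oppr_eq0 => /eqP.
  have Si i : S (f i).
    have := Sf (fun j => (j == i)%:R); rewrite (bigD1 i) //= eqxx scale1r big1 ?addr0 //.
    by move=> j /negPf ->; rewrite scale0r.
  have /(_ (index_enum 'I_m)) : forall s : seq 'I_m, uniq s ->
      S (\sum_(i <- s) c i *: f i) /\
      T (\sum_(i <- s) c i *: f i) = \sum_(i <- s) c i *: T (f i).
    elim=> [|i s IHs]; first by rewrite !big_nil.
    move=> /= /andP[i_s s_uniq]; rewrite !big_cons; have [Ss Ts] := IHs s_uniq.
    split; last by rewrite T_lin // Ts.
    have := Sf (fun j => c j * (j \in i :: s)%:R).
    rewrite (bigID (mem (i :: s))) /= [X in _ + X]big1 ?addr0.
      rewrite -big_uniq /=; last by rewrite i_s.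
      rewrite big_cons inE eqxx mulr1 => h; move: h; congr (S (_ + _)).
      by rewrite big_seq [RHS]big_seq; apply: eq_bigr => j js; rewrite inE js orbT mulr1.
    by move=> j /negPf ->; rewrite mulr0 scale0r.
  by move=> /(_ (index_enum_uniq _))[].
have uniq_poly n1 n2 (e1 : 'I_n1 -> E) (e2 : 'I_n2 -> E) (A1 : 'M[R]_n1) (A2 : 'M[R]_n2) :
    basis_of_set S e1 -> basis_of_set S e2 ->
    (forall j, T (e1 j) = \sum_i A1 i j *: e1 i) ->
    (forall j, T (e2 j) = \sum_i A2 i j *: e2 i) ->
    char_poly A1 = char_poly A2.
  have coords m1 m2 (f1 : 'I_m1 -> E) (f2 : 'I_m2 -> E) :
      basis_of_set S f1 -> basis_of_set S f2 ->
      exists P : 'M[R]_(m1, m2), forall j, f2 j = \sum_i P i j *: f1 i.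
    move=> [_ Sf1] [_ Sf2].
    have : forall j, exists c : 'I_m1 -> R, f2 j = \sum_i c i *: f1 i.
      move=> j; have : S (f2 j); last by rewrite Sf1.
      rewrite Sf2; exists (fun i => (i == j)%:R).
      rewrite (bigD1 j) //= eqxx scale1r big1 ?addr0 //.
      by move=> i /negPf ->; rewrite scale0r.
    move=> /choice[c cE]; exists (\matrix_(i, j) c j i) => j.
    by rewrite cE; apply: eq_bigr => i _; rewrite mxE.
  have free_mx m1 m2 (f1 : 'I_m1 -> E) (P Q : 'M[R]_(m1, m2)) :
      basis_of_set S f1 ->
      (forall j, \sum_i P i j *: f1 i = \sum_i Q i j *: f1 i) -> P = Q.
    move=> [f1_free _] PQ; apply/matrixP => i j; apply/eqP; rewrite -subr_eq0; apply/eqP.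
    apply: (f1_free (fun i => P i j - Q i j)).
    under eq_bigr do rewrite scalerBl.
    by rewrite sumrB PQ subrr.
  have comb m1 m2 m3 (f : 'I_m1 -> E) (P : 'M[R]_(m1, m2)) (Q : 'M[R]_(m2, m3)) j :
      \sum_i Q i j *: (\sum_k P k i *: f k) = \sum_k (P *m Q) k j *: f k.
    under eq_bigr do rewrite scaler_sumr.
    rewrite exchange_big /=; apply: eq_bigr => k _; rewrite mxE scaler_suml.
    by apply: eq_bigr => i _; rewrite scalerA mulrC.
  have one_mx m (f : 'I_m -> E) j : f j = \sum_i (1%:M : 'M[R]_m) i j *: f i.
    rewrite (bigD1 j) //= mxE eqxx scale1r big1 ?addr0 // => i /negPf ij.
    by rewrite mxE ij scale0r.
  move=> b1 b2 T1 T2; have [P PE] := coords _ _ _ _ b1 b2.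
  have [Q QE] := coords _ _ _ _ b2 b1.
  have PQ : P *m Q = 1%:M.
    apply: (free_mx _ _ _ _ _ b1) => j; rewrite -comb -one_mx [RHS]QE.
    by apply: eq_bigr => i _; rewrite -PE.
  have QP : Q *m P = 1%:M.
    apply: (free_mx _ _ _ _ _ b2) => j; rewrite -comb -one_mx [RHS]PE.
    by apply: eq_bigr => i _; rewrite -QE.
  have n12 : n1 = n2 by apply/eqP; rewrite eqn_leq (mulmx1_min PQ) (mulmx1_min QP).
  have A1P : A1 *m P = P *m A2.
    apply: (free_mx _ _ _ _ _ b1) => j; rewrite -!comb.
    under eq_bigr do rewrite -T1.
    under [RHS]eq_bigr do rewrite -PE.
    rewrite -T2 PE T_sum // => c; case: b1 => _ ->.
    by exists c.
  case: _ / n12 in e2 A2 b2 T2 P PE Q QE PQ QP A1P *.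
  by apply: char_poly_intertwine A1P; have [] := mulmx1_unit PQ.
apply: xget_subset1; first by exists n, e, A.
move=> q1 q2 [n1 [e1 [A1 [b1 T1 ->]]]] [n2 [e2 [A2 [b2 T2 ->]]]].
exact: uniq_poly b1 b2 T1 T2.
Qed.

Lemma bilinear_mx n (B : 'rV[R]_n -> 'rV[R]_n -> R) :
  (forall c a a' b, B (c *: a + a') b = c * B a b + B a' b) ->
  (forall c a b b', B a (c *: b + b') = c * B a b + B a b') ->
  exists G : 'M[R]_n, forall a b, B a b = \tr (a *m G *m b^T).
Proof.
move=> Bl Br; exists (\matrix_(i, j) B (delta_mx 0 i) (delta_mx 0 j)) => a b.
have Bl0 c : B 0 c = 0.
  have := Bl 1 0 0 c; rewrite scale1r addr0 mul1r => /eqP.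
  by rewrite -subr_eq0 opprD addNKr oppr_eq0 => /eqP.
have Br0 c : B c 0 = 0.
  have := Br 1 c 0 0; rewrite scale1r addr0 mul1r => /eqP.
  by rewrite -subr_eq0 opprD addNKr oppr_eq0 => /eqP.
have Bsuml (s : seq 'I_n) c d : B (\sum_(i <- s) d i *: delta_mx 0 i) c =
    \sum_(i <- s) d i * B (delta_mx 0 i) c.
  by elim: s => [|i s IHs]; rewrite ?big_nil ?Bl0 // !big_cons Bl IHs.
have Bsumr (s : seq 'I_n) c d : B c (\sum_(i <- s) d i *: delta_mx 0 i) =
    \sum_(i <- s) d i * B c (delta_mx 0 i).
  by elim: s => [|i s IHs]; rewrite ?big_nil ?Br0 // !big_cons Br IHs.
rewrite {1}(row_sum_delta a) {1}(row_sum_delta b) Bsumr mxtrace11 mxE.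
apply: eq_bigr => j _; rewrite Bsuml !mxE mulrC; congr (_ * _).
by apply: eq_bigr => i _; rewrite mxE.
Qed.

Lemma mxtrace_form_inj n (G H : 'M[R]_n) :
  (forall a b : 'rV[R]_n, \tr (a *m G *m b^T) = \tr (a *m H *m b^T)) -> G = H.
Proof.
move=> GH; apply/matrixP => i j; have := GH (delta_mx 0 i) (delta_mx 0 j).
by rewrite -!rowE !mxtrace11 !trmx_delta -!colE !mxE.
Qed.

(** In the coordinates [Phi], if [A] is the matrix of [T], then [H = A^T G]; by symmetry
    [A = invmx G *m H], so a self-adjoint operator becomes a symmetric pencil. *)
Lemma self_adjoint_eigenvalues (E : normedModType R) (S : set E) (T : E -> E)
    (g : E -> E -> R) n (Phi : {linear 'rV[R]_n -> E}) :
  injective Phi -> S = range Phi ->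
  (forall u, S u -> S (T u)) ->
  (forall c u v, S u -> S v -> T (c *: u + v) = c *: T u + T v) ->
  (forall c u v w, g (c *: u + v) w = c * g u w + g v w) ->
  (forall u v, g u v = g v u) ->
  (forall u, S u -> u != 0 -> 0 < g u u) ->
  (forall u v, S u -> S v -> g (T u) v = g (T v) u) ->
  exists G H : 'M[R]_n,
  [/\ spd G, H^T = H,
      forall a b, g (Phi a) (Phi b) = \tr (a *m G *m b^T),
      forall a b, g (T (Phi a)) (Phi b) = \tr (a *m H *m b^T) &
      op_eigenvalues S T = sorted_roots (char_poly (invmx G *m H))].
Proof.
move=> Phi_inj SE TS T_lin g_lin g_sym g_pos T_sym.
have SPhi a : S (Phi a) by rewrite SE; exists a.
have [c a a' b|c a b b'|G GE] := @bilinear_mx n (fun a b => g (Phi a) (Phi b)).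
- by rewrite linearP g_lin.
- by rewrite g_sym linearP g_lin !(g_sym _ (Phi a)).
have [c a a' b|c a b b'|H HE] := @bilinear_mx n (fun a b => g (T (Phi a)) (Phi b)).
- by rewrite linearP T_lin // g_lin.
- by rewrite T_sym // linearP T_lin // g_lin !(T_sym (Phi a)).
have G_sym : G^T = G.
  apply: mxtrace_form_inj => a b; rewrite -GE g_sym GE -[RHS]mxtrace_tr.
  by rewrite !trmx_mul trmxK mulmxA.
have H_sym : H^T = H.
  apply: mxtrace_form_inj => a b; rewrite -HE T_sym // HE -[RHS]mxtrace_tr.
  by rewrite !trmx_mul trmxK mulmxA.
have G_spd : spd G.
  split => // v v0; rewrite -mxtrace11 -{2}[v]trmxK -GE g_pos //.
  by rewrite -(inj_eq (can_inj (@trmxK R _ _))) trmx0 -(linear0 Phi) (inj_eq Phi_inj) in v0 *.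
exists G, H; split => //; congr sorted_roots.
have : forall j : 'I_n, exists c : 'rV[R]_n, T (Phi (delta_mx 0 j)) = Phi c.
  by move=> j; have := TS _ (SPhi (delta_mx 0 j)); rewrite SE => -[c _ <-]; exists c.
move=> /choice[c cE]; pose A : 'M[R]_n := \matrix_(i, j) c j 0 i.
have Phi_sum a : Phi a = \sum_i a 0 i *: Phi (delta_mx 0 i).
  by rewrite {1}[a]row_sum_delta linear_sum; apply: eq_bigr => i _; rewrite linearZ.
have -> : invmx G *m H = A.
  apply: (can_inj (mulKmx (spd_unitmx G_spd))); rewrite mulKVmx ?spd_unitmx //.
  rewrite -H_sym -G_sym -[RHS]trmxK; congr trmx; rewrite trmx_mul trmxK.
  apply/matrixP => i j; have := HE (delta_mx 0 i) (delta_mx 0 j).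
  rewrite cE GE -rowE !trmx_delta -!colE !mxtrace11 !mxE => <-.
  by apply: eq_bigr => k _; rewrite !mxE.
apply: op_char_polyE (fun i => Phi (delta_mx 0 i)) _ T_lin _ _.
  split=> [d d0 i|].
    have : Phi (\row_j d j) = 0.
      by rewrite Phi_sum -[RHS]d0; apply: eq_bigr => j _; rewrite mxE.
    by rewrite -(linear0 Phi) => /Phi_inj/rowP/(_ i); rewrite !mxE.
  rewrite SE; apply/seteqP; split=> [_ [a _ <-]|_ [d ->]].
    by exists (fun i => a 0 i); rewrite -Phi_sum.
  exists (\row_j d j) => //; rewrite Phi_sum.
  by apply: eq_bigr => j _; rewrite mxE.
by move=> j; rewrite cE Phi_sum; apply: eq_bigr => i _; rewrite mxE.
Qed.

Lemma size_sorted_roots_pencil n (G H : 'M[R]_n) : spd G -> H^T = H ->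
  size (sorted_roots (char_poly (invmx G *m H))) = n.
Proof.
by move=> Gs Hs; have [P [s [sn ss _ _ ->]]] := spd_pencil Gs Hs; rewrite sorted_rootsE.
Qed.

(** Read on the same coordinate space, the two operators have the same form matrix and differ by
    their Gram matrices. Symmetry is assumed of [T'] and passes to [T] through the equality of the
    forms. *)
Lemma intertwined_spectra_sandwich (E F : normedModType R)
    (S : set E) (T : E -> E) (g : E -> E -> R)
    (S' : set F) (T' : F -> F) (g' : F -> F -> R)
    n (Phi : {linear 'rV[R]_n -> E}) (Phi' : {linear 'rV[R]_n -> F}) (alpha beta : R) :
  injective Phi -> S = range Phi ->
  (forall u, S u -> S (T u)) ->
  (forall c u v, S u -> S v -> T (c *: u + v) = c *: T u + T v) ->
  (forall c u v w, g (c *: u + v) w = c * g u w + g v w) ->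
  (forall u v, g u v = g v u) ->
  (forall u, S u -> u != 0 -> 0 < g u u) ->
  injective Phi' -> S' = range Phi' ->
  (forall u, S' u -> S' (T' u)) ->
  (forall c u v, S' u -> S' v -> T' (c *: u + v) = c *: T' u + T' v) ->
  (forall c u v w, g' (c *: u + v) w = c * g' u w + g' v w) ->
  (forall u v, g' u v = g' v u) ->
  (forall u, S' u -> u != 0 -> 0 < g' u u) ->
  (forall u v, S' u -> S' v -> g' (T' u) v = g' (T' v) u) ->
  (forall a b, g (T (Phi a)) (Phi b) = g' (T' (Phi' a)) (Phi' b)) ->
  (forall a, alpha * g (Phi a) (Phi a) <= g' (Phi' a) (Phi' a)
             <= beta * g (Phi a) (Phi a)) ->
  size (op_eigenvalues S T) = n /\
  forall i, (1 <= i <= n)%N ->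
    sandwiched (lambda i S T) (alpha * lambda i S' T') (beta * lambda i S' T').
Proof.
move=> P1 P2 P3 P4 P5 P6 P7 Q1 Q2 Q3 Q4 Q5 Q6 Q7 Q8 TT' gg'.
have [|G1 [H1 [G1s H1s G1E H1E eig1]]] := self_adjoint_eigenvalues P1 P2 P3 P4 P5 P6 P7.
  rewrite P2 => _ _ [a _ <-] [b _ <-]; rewrite !TT' Q8 // Q2.
  - by exists a.
  - by exists b.
have [G2 [H2 [G2s H2s G2E H2E eig2]]] := self_adjoint_eigenvalues Q1 Q2 Q3 Q4 Q5 Q6 Q7 Q8.
have H12 : H1 = H2 by apply: mxtrace_form_inj => a b; rewrite -H1E -H2E TT'.
split; first by rewrite eig1 size_sorted_roots_pencil.
case=> // i /= ltin; rewrite /sandwiched /lambda eig1 eig2 /= -H12.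
apply: pencils_sandwich => // w; rewrite -G1E -G2E; exact: gg'.
Qed.

End Operators.

(** * Continuously differentiable functions *)

Section ContinuouslyDifferentiable.
Variable R : realType.

Lemma mx_continuous_at (T : topologicalType) m n (F : T -> 'M[R]_(m, n)) x :
  (forall i j, {for x, continuous (fun y => F y i j)}) -> {for x, continuous F}.
Proof.
move=> Fc; apply/cvgrPdist_le => /= e e0; near=> y.
rewrite /Num.Def.normr/= mx_normrE (bigmax_le _ (ltW e0))//= => i _.
rewrite !mxE/=; move: i; near: y; apply: filter_forall => /= i.
exact: ((cvgrPdist_le _ _).1 (Fc i.1 i.2)).
Unshelve. all: by end_near. Qed.

Lemma mx_entry_continuous_at (T : topologicalType) m n (F : T -> 'M[R]_(m, n)) x i j :
  {for x, continuous F} -> {for x, continuous (fun y => F y i j)}.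
Proof.
move=> Fc; apply: (@continuous_comp _ _ _ F (fun M : 'M[R]_(m, n) => M i j)) => //.
exact: coord_continuous.
Qed.

Lemma is_derive_mxP (V : normedModType R) m n (F : V -> 'M[R]_(m, n)) x v dF :
  is_derive x v F dF <-> forall i j, is_derive x v (fun y => F y i j) (dF i j).
Proof.
split=> [[Fd <-] i j|Fd].
  by have /derivable_mxP/(_ i j) Fij := Fd; apply: DeriveDef => //; rewrite derive_mx // mxE.
have Fdd : derivable F x v by apply/derivable_mxP => i j; case: (Fd i j).
apply: DeriveDef => //; rewrite derive_mx //; apply/matrixP => i j; rewrite mxE.
by case: (Fd i j).
Qed.

Lemma differentiable_mxP (V : normedModType R) m n (F : V -> 'M[R]_(m, n)) x :
  differentiable F x <-> forall i j, differentiable (fun y => F y i j) x.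
Proof.
split=> [Fd i j|Fd].
  apply: (@differentiable_comp _ _ _ _ F (fun M : 'M[R]_(m, n) => M i j)) => //.
  exact: differentiable_coord.
have -> : F = \sum_i \sum_j (fun y => F y i j *: delta_mx i j).
  apply/funext => y; rewrite fct_sumE [LHS]matrix_sum_delta.
  by apply: eq_bigr => i _; rewrite fct_sumE.
apply: differentiable_sum => i; apply: differentiable_sum => j.
exact: differentiableZl.
Qed.

Lemma near_eq_differentiable (V W : normedModType R) (F G : V -> W) x :
  (\forall y \near x, F y = G y) -> differentiable F x -> differentiable G x.
Proof.
move=> FG Fd.
have FGx : F x = G x := nbhs_singleton FG.
have dG : continuous ('d F x) /\ G \o shift x = cst (G x) + 'd F x +o_ 0 id.
  split; first exact: diff_continuous.
  have [_ /eqaddoP FE] := (diff_locallyP _ _).1 Fd.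
  apply/eqaddoP => e e0; have Fe := FE _ e0.
  have FG0 : \forall y \near 0, F (y + x) = G (y + x).
    by move: FG; rewrite (near_shift 0) subr0.
  near=> y; rewrite /= !fctE /= -FGx.
  have <- : F (y + x) = G (y + x) by near: y.
  by near: y.
apply/diff_locallyP; rewrite (_ : 'd G x = 'd F x :> (V -> W)) //.
by apply: diff_unique; case: dG.
Unshelve. all: by end_near. Qed.

Section ScalarValued.
Variables (V : normedModType R) (A : set V).
Hypothesis A_open : open A.

(** A formula [g] for the derivative has to hold on [A] only: as [A] is open, it agrees with the
    derivative near each of its points, so continuity transfers. *)
Lemma C1_intro (W : normedModType R) (F : V -> W) :
  (forall x, A x -> differentiable F x) ->
  (forall v, exists2 g, (forall x, A x -> 'D_v F x = g x) &
                        forall x, A x -> {for x, continuous g}) ->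
  Ck_on A 1 F.
Proof.
move=> Fd FD; split=> // v x Ax; have [g FE gc] := FD v.
have near_g : \forall y \near x, g y = 'D_v F y.
  by near=> y; rewrite FE //; near: y; exact: open_nbhs_nbhs.
rewrite /prop_for /continuous_at FE //.
apply: cvg_trans (gc _ Ax); exact: near_eq_cvg.
Unshelve. all: by end_near. Qed.

Lemma C1_differentiable (W : normedModType R) (F : V -> W) x :
  Ck_on A 1 F -> A x -> differentiable F x.
Proof. by case=> Fd _; exact: Fd. Qed.

Lemma C1_continuous (W : normedModType R) (F : V -> W) x :
  Ck_on A 1 F -> A x -> {for x, continuous F}.
Proof. by move=> F1 Ax; apply: differentiable_continuous; exact: C1_differentiable Ax. Qed.

Lemma C1_eq (W : normedModType R) (F G : V -> W) :
  (forall x, A x -> F x = G x) -> Ck_on A 1 F -> Ck_on A 1 G.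
Proof.
move=> FG [Fd FD].
have near_FG x : A x -> \forall y \near x, F y = G y.
  by move=> Ax; near=> y; apply: FG; near: y; exact: open_nbhs_nbhs.
apply: C1_intro => [x Ax|v].
  by apply: near_eq_differentiable (Fd _ Ax); exact: near_FG.
exists ('D_v F); last by move=> x; exact: FD.
by move=> x Ax; apply: near_eq_derive; have := near_FG _ Ax; apply: filterS => y ->.
Unshelve. all: by end_near. Qed.

Lemma C1_cst (W : normedModType R) (a : W) : Ck_on A 1 (fun=> a : W).
Proof.
apply: C1_intro => [x _|v]; first exact: differentiable_cst.
exists (fun=> 0) => [x _|x _]; first exact: derive_cst.
exact: cst_continuous.
Qed.

Lemma C1_lin (W : normedModType R) (L : {linear V -> W}) : continuous L -> Ck_on A 1 L.
Proof.
move=> Lc; apply: C1_intro => [x _|v]; first exact: linear_differentiable.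
exists (fun=> L v) => [x _|x _]; last exact: cst_continuous.
by rewrite deriveE ?diff_lin //; exact: linear_differentiable.
Qed.

Lemma C1D (W : normedModType R) (F G : V -> W) : Ck_on A 1 F -> Ck_on A 1 G ->
  Ck_on A 1 (fun x => F x + G x).
Proof.
move=> [Fd FD] [Gd GD]; apply: C1_intro => [x Ax|v].
  by apply: differentiableD; [exact: Fd|exact: Gd].
exists (fun x => 'D_v F x + 'D_v G x) => x Ax.
  by apply: deriveD; apply: diff_derivable; [exact: Fd|exact: Gd].
by apply: continuousD; [exact: FD|exact: GD].
Qed.

Lemma C1M (F G : V -> R) : Ck_on A 1 F -> Ck_on A 1 G -> Ck_on A 1 (fun x => F x * G x).
Proof.
move=> F1 G1; have [Fd FD] := F1; have [Gd GD] := G1; apply: C1_intro => [x Ax|v].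
  by apply: differentiableM; [exact: Fd|exact: Gd].
exists (fun x => F x * 'D_v G x + G x * 'D_v F x) => x Ax.
  by apply: deriveM; apply: diff_derivable; [exact: Fd|exact: Gd].
have Fc := C1_continuous F1 Ax; have Gc := C1_continuous G1 Ax.
by apply: continuousD; apply: continuousM => //; [exact: GD|exact: FD].
Qed.

Lemma C1V (F : V -> R) : (forall x, A x -> F x != 0) -> Ck_on A 1 F ->
  Ck_on A 1 (fun x => (F x)^-1).
Proof.
move=> F0 F1; have [Fd FD] := F1; apply: C1_intro => [x Ax|v].
  by apply: differentiableV; [exact: Fd|exact: F0].
exists (fun x => - ((F x)^-1 * (F x)^-1) * 'D_v F x) => x Ax.
  rewrite (deriveV (F0 _ Ax)); last exact/diff_derivable/Fd.
  by rewrite -[_ ^- 2]/((_ * _)^-1) invfM.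
have Fi : {for x, continuous (fun x => (F x)^-1)}.
  by apply: continuousV; [exact: F0|exact: C1_continuous].
apply: continuousM; last exact: FD.
by apply: continuousN; apply: continuousM.
Qed.

Lemma C1_sum (W : normedModType R) (I : Type) (s : seq I) (P : pred I) (F : I -> V -> W) :
  (forall i, Ck_on A 1 (F i)) -> Ck_on A 1 (fun x => \sum_(i <- s | P i) F i x).
Proof.
move=> F1; elim: s => [|i s IHs].
  by apply: C1_eq (C1_cst 0) => x _; rewrite big_nil.
case Pi : (P i).
  by apply: C1_eq (C1D (F1 i) IHs) => x _; rewrite big_cons Pi.
by apply: C1_eq IHs => x _; rewrite big_cons Pi.
Qed.

Lemma C1_prod (I : Type) (s : seq I) (P : pred I) (F : I -> V -> R) :
  (forall i, Ck_on A 1 (F i)) -> Ck_on A 1 (fun x => \prod_(i <- s | P i) F i x).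
Proof.
move=> F1; elim: s => [|i s IHs].
  by apply: C1_eq (C1_cst (1 : R)) => x _; rewrite big_nil.
case Pi : (P i).
  by apply: C1_eq (C1M (F1 i) IHs) => x _; rewrite big_cons Pi.
by apply: C1_eq IHs => x _; rewrite big_cons Pi.
Qed.

End ScalarValued.

End ContinuouslyDifferentiable.

(** * Differential calculus of matrix-valued functions *)

Section MatrixCalculus.
Variable R : realType.

Section MatrixValued.
Variables (V : normedModType R) (A : set V).
Hypothesis A_open : open A.

Lemma C1_mxP m n (F : V -> 'M[R]_(m, n)) :
  Ck_on A 1 F <-> forall i j, Ck_on A 1 (fun y => F y i j).
Proof.
split=> [[Fd FD] i j|F1]; apply: C1_intro => // [x Ax|v].
- by have /differentiable_mxP := Fd _ Ax; exact.
- exists (fun x => 'D_v F x i j) => x Ax.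
    by rewrite derive_mx ?mxE //; apply: diff_derivable; exact: Fd.
  by apply: mx_entry_continuous_at; exact: FD.
- by apply/differentiable_mxP => i j; exact: C1_differentiable (F1 i j) Ax.
exists (fun x => \matrix_(i, j) 'D_v (fun y => F y i j) x) => x Ax.
  rewrite derive_mx //; apply: diff_derivable; apply/differentiable_mxP => i j.
  exact: C1_differentiable (F1 i j) Ax.
apply: mx_continuous_at => i j.
rewrite (_ : (fun y => _) = 'D_v (fun y => F y i j)).
  exact: (F1 i j).2 v x Ax.
by apply/funext => y; rewrite mxE.
Qed.

Lemma C1_mulmx m n p (F : V -> 'M[R]_(m, n)) (G : V -> 'M[R]_(n, p)) :
  Ck_on A 1 F -> Ck_on A 1 G -> Ck_on A 1 (fun x => F x *m G x).
Proof.
move=> /C1_mxP F1 /C1_mxP G1; apply/C1_mxP => i j.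
apply: (C1_eq A_open (F := fun x => \sum_k F x i k * G x k j)).
  by move=> x _; rewrite mxE.
by apply: C1_sum => // k; exact: C1M.
Qed.

Lemma C1_trmx m n (F : V -> 'M[R]_(m, n)) : Ck_on A 1 F -> Ck_on A 1 (fun x => (F x)^T).
Proof.
move=> /C1_mxP F1; apply/C1_mxP => i j.
by apply: C1_eq (F1 j i) => // x _; rewrite mxE.
Qed.

Lemma C1_oppmx m n (F : V -> 'M[R]_(m, n)) : Ck_on A 1 F -> Ck_on A 1 (fun x => - F x).
Proof.
move=> /C1_mxP F1; apply/C1_mxP => i j.
apply: C1_eq (C1M A_open (C1_cst A_open (-1 : R)) (F1 i j)) => // x _.
by rewrite mxE mulN1r.
Qed.

Lemma C1_det n (F : V -> 'M[R]_n) : Ck_on A 1 F -> Ck_on A 1 (fun x => \det (F x)).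
Proof.
move=> /C1_mxP F1; apply: C1_sum => // s; apply: C1M => //; first exact: C1_cst.
by apply: C1_prod => // i; exact: F1.
Qed.

Lemma C1_mxtrace n (F : V -> 'M[R]_n) : Ck_on A 1 F -> Ck_on A 1 (fun x => \tr (F x)).
Proof. by move=> /C1_mxP F1; apply: C1_sum => // i; exact: F1. Qed.

Lemma C1_invmx n (F : V -> 'M[R]_n) : (forall x, A x -> F x \in unitmx) ->
  Ck_on A 1 F -> Ck_on A 1 (fun x => invmx (F x)).
Proof.
move=> Fu F1; apply/C1_mxP => i j.
apply: (C1_eq A_open (F := fun x => (\det (F x))^-1 * \adj (F x) i j)).
  by move=> x Ax; rewrite /invmx Fu // !mxE.
apply: C1M => //; first apply: C1V => //.
- by move=> x /Fu; rewrite unitmxE unitfE.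
- exact: C1_det.
apply: (C1_eq A_open (F := fun x => (-1) ^+ (j + i) * \det (row' j (col' i (F x))))).
  by move=> x _; rewrite mxE.
apply: C1M => //; first exact: C1_cst.
apply: C1_det; apply/C1_mxP => k l; move/C1_mxP: F1 => F1.
by apply: C1_eq (F1 (lift j k) (lift i l)) => // x _; rewrite !mxE.
Qed.

(** In the chain rule the direction ['D_v F x] varies with [x], whereas [Ck_on] controls derivatives
    along fixed vectors; expanding the direction on the matrix units reconciles the two. *)
Lemma C1_comp_mx m n (B : set 'M[R]_(m, n)) (W : normedModType R)
    (F : V -> 'M[R]_(m, n)) (phi : 'M[R]_(m, n) -> W) :
  (forall x, A x -> B (F x)) -> Ck_on A 1 F -> Ck_on B 1 phi ->
  Ck_on A 1 (fun x => phi (F x)).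
Proof.
move=> AB F1 [phid phiD]; have [Fd FD] := F1; apply: C1_intro => // [x Ax|v].
  by apply: differentiable_comp; [exact: Fd|exact/phid/AB].
exists (fun x => \sum_i \sum_j ('D_v F x i j *: 'D_(delta_mx i j) phi (F x))) => x Ax.
  have phidx := phid _ (AB _ Ax); have Fdx := Fd _ Ax.
  rewrite deriveE; last by apply: (differentiable_comp Fdx).
  rewrite (diff_comp Fdx phidx) /= -(deriveE _ Fdx).
  rewrite {1}['D_v F x]matrix_sum_delta linear_sum; apply: eq_bigr => i _.
  rewrite linear_sum; apply: eq_bigr => j _.
  by rewrite linearZ /= (deriveE _ phidx).
have Fc : {for x, continuous F} by exact: C1_continuous Ax.
apply: cvg_big => [|i _]; first exact: add_continuous.
apply: cvg_big => [|j _]; first exact: add_continuous.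
apply: cvgZ; first exact: (mx_entry_continuous_at (FD v x Ax)).
apply: (@continuous_comp _ _ _ F ('D_(delta_mx i j) phi)) => //.
exact/phiD/AB.
Qed.

End MatrixValued.

Lemma derive_pair (V W1 W2 : normedModType R) (F : V -> W1) (G : V -> W2) x v :
  differentiable F x -> differentiable G x ->
  'D_v (fun y => (F y, G y)) x = ('D_v F x, 'D_v G x).
Proof.
move=> Fd Gd; rewrite !deriveE //; last exact: differentiable_pair.
by rewrite diff_pair.
Qed.

Lemma C1_pair (V W1 W2 : normedModType R) (A : set V) (F : V -> W1) (G : V -> W2) :
  open A -> Ck_on A 1 F -> Ck_on A 1 G -> Ck_on A 1 (fun x => (F x, G x)).
Proof.
move=> A_open [Fd FD] [Gd GD]; apply: C1_intro => // [x Ax|v].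
  by apply: differentiable_pair; [exact: Fd|exact: Gd].
exists (fun x => ('D_v F x, 'D_v G x)) => x Ax.
  by rewrite derive_pair //; [exact: Fd|exact: Gd].
by apply: cvg_pair; [exact: FD|exact: GD].
Qed.

Lemma C1_fst (W1 W2 : normedModType R) (A : set (W1 * W2)%type) :
  open A -> Ck_on A 1 (@fst W1 W2).
Proof. by move=> A_open; apply: (C1_lin A_open (L := fst)) => x; exact: cvg_fst. Qed.

Lemma C1_snd (W1 W2 : normedModType R) (A : set (W1 * W2)%type) :
  open A -> Ck_on A 1 (@snd W1 W2).
Proof. by move=> A_open; apply: (C1_lin A_open (L := snd)) => x; exact: cvg_snd. Qed.

Lemma C1_id (V : normedModType R) (A : set V) : open A -> Ck_on A 1 (@id V).
Proof. by move=> A_open; apply: (C1_lin A_open (L := idfun)) => x; exact: cvg_id. Qed.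

Lemma is_derive_mulmx (V : normedModType R) m n p (F : V -> 'M[R]_(m, n))
    (G : V -> 'M[R]_(n, p)) x v dF dG :
  is_derive x v F dF -> is_derive x v G dG ->
  is_derive x v (fun y => F y *m G y) (dF *m G x + F x *m dG).
Proof.
move=> /is_derive_mxP Fd /is_derive_mxP Gd; apply/is_derive_mxP => i j.
rewrite (_ : (fun y => _) = \sum_k (fun y => F y i k * G y k j)); last first.
  by apply/funext => y; rewrite fct_sumE mxE.
rewrite !mxE -big_split /=; apply: is_derive_sum => k.
apply: (is_derive_eq (is_deriveM (Fd i k) (Gd k j))).
by rewrite -[LHS]/(F x i k * dG k j + G x k j * dF i k) [LHS]addrC [G x k j * _]mulrC.
Qed.

Lemma is_derive_trmx (V : normedModType R) m n (F : V -> 'M[R]_(m, n)) x v dF :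
  is_derive x v F dF -> is_derive x v (fun y => (F y)^T) dF^T.
Proof.
move=> /is_derive_mxP Fd; apply/is_derive_mxP => i j; rewrite mxE.
by rewrite (_ : (fun y => _) = fun y => F y j i) //; apply/funext => y; rewrite mxE.
Qed.

Lemma is_derive_mxtrace (V : normedModType R) n (F : V -> 'M[R]_n) x v dF :
  is_derive x v F dF -> is_derive x v (fun y => \tr (F y)) (\tr dF).
Proof.
move=> /is_derive_mxP Fd; rewrite (_ : (fun y => _) = \sum_k (fun y => F y k k)).
  exact: is_derive_sum.
by apply/funext => y; rewrite fct_sumE.
Qed.

Lemma differentiable_is_derive (V W : normedModType R) (F : V -> W) x v :
  differentiable F x -> is_derive x v F ('D_v F x).
Proof. by move=> Fd; apply: DeriveDef => //; exact: diff_derivable. Qed.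

Lemma is_derive_diff_comp (U V W : normedModType R) (G : U -> V) (F : V -> W) x v :
  differentiable G x -> differentiable F (G x) ->
  is_derive x v (fun y => F (G y)) ('D_('D_v G x) F (G x)).
Proof.
move=> Gd Fd; apply: DeriveDef.
  by apply: diff_derivable; apply: differentiable_comp.
rewrite deriveE; last exact: differentiable_comp.
by rewrite diff_comp //= !deriveE.
Qed.

Lemma is_derive_curve_comp (V W : normedModType R) (c : R -> V) (F : V -> W) t v :
  is_derive t (1 : R) c v -> differentiable F (c t) ->
  is_derive t (1 : R) (fun s => F (c s)) ('D_v F (c t)).
Proof.
move=> [cd <-] Fd; apply: is_derive_diff_comp => //; exact/derivable1_diffP.
Qed.

Lemma is_derive_fst (V W1 W2 : normedModType R) (F : V -> (W1 * W2)%type) x v dF :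
  differentiable F x -> is_derive x v F dF -> is_derive x v (fun y => (F y).1) dF.1.
Proof.
move=> Fd [_ <-].
have fstd y : differentiable (@fst W1 W2) y.
  by apply: (C1_differentiable (C1_fst openT)).
apply: is_derive_eq; first exact: (is_derive_diff_comp _ Fd).
by rewrite deriveE // (@diff_lin _ _ _ fst) // => y; exact: cvg_fst.
Qed.

Lemma is_derive_snd (V W1 W2 : normedModType R) (F : V -> (W1 * W2)%type) x v dF :
  differentiable F x -> is_derive x v F dF -> is_derive x v (fun y => (F y).2) dF.2.
Proof.
move=> Fd [_ <-].
have sndd y : differentiable (@snd W1 W2) y.
  by apply: (C1_differentiable (C1_snd openT)).
apply: is_derive_eq; first exact: (is_derive_diff_comp _ Fd).
by rewrite deriveE // (@diff_lin _ _ _ snd) // => y; exact: cvg_snd.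
Qed.

Lemma derive_linear_mx (W : normedModType R) m n (phi : 'M[R]_(m, n) -> W) x v :
  differentiable phi x -> 'D_v phi x = \sum_i \sum_j v i j *: 'D_(delta_mx i j) phi x.
Proof.
move=> phid; rewrite deriveE // {1}[v]matrix_sum_delta linear_sum; apply: eq_bigr => i _.
by rewrite linear_sum; apply: eq_bigr => j _; rewrite linearZ /= deriveE.
Qed.

End MatrixCalculus.

(** * Tangent vectors and derivatives along a subset *)

Section DerivativeAlong.
Variable R : realType.
Implicit Types V : normedModType R.

Lemma curve_near V (A : set V) x v c (B : set V) : curve_in A x v c ->
  nbhs x B -> \forall t \near (0 : R), A (c t) /\ B (c t).
Proof.
move=> [c0 cA _ [cd _]] Bx; near=> t; split; first by near: t.
near: t; have /differentiable_continuous cc : differentiable c (0 : R).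
  exact/derivable1_diffP.
by apply: cc; rewrite c0.
Unshelve. all: by end_near. Qed.

(** By the chain rule every curve with velocity [v] yields the derivative of the extension [Phi];
    this is what makes [dalong] independent of the curve. *)
Lemma dalongE V (A : set V) (phi Phi : V -> R) x v : tangent A x v ->
  differentiable Phi x -> (\forall y \near x, A y -> phi y = Phi y) ->
  dalong A phi x v = 'D_v Phi x.
Proof.
move=> [c0 c0_curve] Phid phiPhi.
have d_curve c : curve_in A x v c -> is_derive (0 : R) (1 : R) (phi \o c) ('D_v Phi x).
  move=> c_curve; have [cx _ _ cd] := c_curve.
  apply: (near_eq_is_derive (f := fun t => Phi (c t))); last first.
    by rewrite -cx; apply: is_derive_curve_comp => //; rewrite cx.
  have := curve_near c_curve phiPhi; apply: filterS => t /= [Act ->//].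
apply: xget_subset1; first by exists c0 => //; exact: d_curve.
move=> d1 d2 [c1 /d_curve[_ c1E] [_ <-]] [c2 /d_curve[_ c2E] [_ <-]].
by rewrite c1E c2E.
Qed.

Lemma tangent_intro V (A : set V) (B : set R) x v (c : R -> V) :
  open B -> B 0 -> c 0 = x -> (\forall t \near (0 : R), A (c t)) -> Ck_on B 1 c ->
  is_derive (0 : R) (1 : R) c v -> tangent A x v.
Proof.
move=> B_open B0 cx cA [cd cD] cv; exists c; split=> //.
have /nbhs_ballP[e /= e0 eB] : nbhs (0 : R) B by apply: open_nbhs_nbhs.
by exists e => //; split=> [t /eB|w t /eB]; [exact: cd|exact: cD].
Qed.

End DerivativeAlong.

(** * The fixed-rank manifold *)

Section RankManifold.
Variable R : realType.

Lemma open_unitmx n : open [set A : 'M[R]_n | A \in unitmx].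
Proof.
rewrite (_ : [set _ | _] = (fun A : 'M[R]_n => \det A) @^-1` [set x : R | x != 0]).
  apply: open_comp; last exact: open_neq.
  by move=> A _; apply: (C1_continuous (C1_det openT (C1_id openT))).
by apply/seteqP; split=> A /=; rewrite unitmxE unitfE.
Qed.

Lemma open_preimage_unitmx (V : normedModType R) n (F : V -> 'M[R]_n) :
  Ck_on [set: V] 1 F -> open [set x | F x \in unitmx].
Proof.
move=> F1; rewrite (_ : [set _ | _] = F @^-1` [set A : 'M[R]_n | A \in unitmx]) //.
apply: open_comp; last exact: open_unitmx.
by move=> x _; apply: (C1_continuous F1).
Qed.

Lemma near_unitmx (V : normedModType R) n (F : V -> 'M[R]_n) x :
  {for x, continuous F} -> F x \in unitmx -> \forall y \near x, F y \in unitmx.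
Proof.
move=> Fc Fx; apply: (Fc [set A : 'M[R]_n | A \in unitmx]).
by apply: open_nbhs_nbhs; split; [exact: open_unitmx|].
Qed.

Lemma is_derive_scalel m n (A : 'M[R]_(m, n)) (t : R) :
  is_derive t (1 : R) (fun s : R => s *: A) A.
Proof.
apply/is_derive_mxP => i j; rewrite (_ : (fun y => _) = id * cst (A i j)); last first.
  by apply/funext => s; rewrite mxE.
by apply: is_derive_eq; rewrite scaler0 add0r /cst; exact: mulr1.
Qed.

Lemma C1_scalel m n (A : 'M[R]_(m, n)) (B : set R) : open B ->
  Ck_on B 1 (fun s : R => s *: A).
Proof.
move=> B_open; apply/C1_mxP => // i j.
apply: (C1_eq B_open (F := fun s => s * A i j)); first by move=> s _; rewrite mxE.
by apply: C1M => //; [exact: C1_id|exact: C1_cst].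
Qed.

Lemma is_derive_invmx n (F : R -> 'M[R]_n) t dF : is_derive t (1 : R) F dF ->
  F t \in unitmx ->
  is_derive t (1 : R) (fun s => invmx (F s)) (- (invmx (F t) *m dF *m invmx (F t))).
Proof.
move=> Fd Fu; pose D := 'D_dF (fun A : 'M[R]_n => invmx A) (F t).
have Nd : is_derive t (1 : R) (fun s => invmx (F s)) D.
  apply: (is_derive_curve_comp (F := fun A : 'M[R]_n => invmx A)) => //.
  apply: (C1_differentiable (A := [set A | A \in unitmx])) => //.
  by apply: C1_invmx => //; [exact: open_unitmx|exact: (C1_id (@open_unitmx n))].
apply: (is_derive_eq Nd).
have Fc : {for t, continuous F}.
  by apply: differentiable_continuous; apply/derivable1_diffP; case: Fd.
have Pd := is_derive_mulmx Nd Fd.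
have P1 : is_derive t (1 : R) (fun s => invmx (F s) *m F s) 0.
  apply: (near_eq_is_derive (f := fun=> 1%:M)).
  by have := near_unitmx Fc Fu; apply: filterS => s Fs; rewrite mulVmx.
(* Differentiability being settled, the value comes from differentiating [invmx (F s) *m F s = 1]
   near [t]. *)
have : D *m F t + invmx (F t) *m dF = 0.
  by case: Pd => _ <-; case: P1 => _ <-.
move/(congr1 (mulmx^~ (invmx (F t)))); rewrite /= mulmxDl mul0mx mulmxK //.
by move/eqP; rewrite addr_eq0 => /eqP.
Qed.

(** A rank factorization is orthonormalized: the congruence [P] turns the Gram matrix of the column
    factor into the identity, and the row factor absorbs the inverse. Every matrix of rank [r] can
    thus be treated as [U Y^T]. *)
Lemma full_rank_factorization p1 p2 r (X : 'M[R]_(p1, p2)) : \rank X = r ->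
  exists (U : 'M[R]_(p1, r)) (Y : 'M[R]_(p2, r)),
    [/\ stiefel U, full_col_rank Y & X = U *m Y^T].
Proof.
move=> <-; move: (col_base_full X) (mulmx_base X) (row_base_free X).
move: (col_base X) (row_base X) => C D C_col CD /eqP Dr.
have C_spd : spd (C^T *m C).
  have C_full : full_col_rank C by exact/eqP.
  split=> [|v v0]; first by rewrite trmx_mul trmxK.
  have -> : v^T *m (C^T *m C) *m v = (C *m v)^T *m (C *m v) by rewrite trmx_mul !mulmxA.
  rewrite -mxtrace11 mxtrace_trmul_gt0 //.
  apply: contra_neq v0 => Cv; have := congr1 (mulmx (C^T)) Cv; rewrite mulmxA mulmx0.
  move/full_col_rank_unit: C_full => Cu.
  by move/(congr1 (mulmx (invmx (C^T *m C)))); rewrite mulKmx // mulmx0.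
have [P [s [_ _ Pu [PC _] _]]] := spd_pencil C_spd (trmx1 R (\rank X)).
have PTu : P^T \in unitmx by rewrite unitmx_tr.
exists (C *m P^T), (invmx P^T *m D)^T; split.
- by rewrite /stiefel /= trmx_mul trmxK -mulmxA [C^T *m _]mulmxA mulmxA.
- rewrite /full_col_rank /= mxrank_tr -mxrank_tr trmx_mul mxrankMfree ?mxrank_tr //.
  by rewrite row_free_unit unitmx_tr unitmx_inv.
by rewrite trmxK mulmxA mulmxK.
Qed.

(** Since [A C B] has rank [r], so has [A C], and its rows span the row space of [C]: [C = K A C]
    for some [K], which multiplication by [B] identifies. *)
Lemma low_rank_cur p1 p2 r (C : 'M[R]_(p1, p2)) (A : 'M[R]_(r, p1)) (B : 'M[R]_(p2, r)) :
  \rank C = r -> A *m C *m B \in unitmx ->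
  C = C *m B *m invmx (A *m C *m B) *m (A *m C).
Proof.
move=> Cr ACB; have /submxP[K CK] : (C <= A *m C)%MS.
  have [_ <-] := mxrank_leqif_sup (submxMl A C).
  rewrite Cr eqn_leq rank_leq_row /=.
  by rewrite -[X in (X <= _)%N](mxrank_unit ACB) mxrankM_maxl.
have CB : C *m B = K *m (A *m C *m B) by rewrite {1}CK !mulmxA.
by rewrite CB mulmxK.
Qed.

(** * Tangent spaces of the fixed-rank manifold *)

Section TangentSpace.
Variables (p1 p2 r : nat) (U : 'M[R]_(p1, r)) (Y : 'M[R]_(p2, r)).
Hypotheses (U_st : stiefel U) (Y_full : full_col_rank Y).
(** The transposed pseudo-inverse of [Y]; [Yp *m Y^T] is the orthogonal projector onto the column
    space of [Y]. *)
Let Yp := Y *m invmx (Y^T *m Y).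

Lemma trmul_full_rank_pinv : Y^T *m Yp = 1%:M.
Proof. by rewrite mulmxA mulmxV //; exact/full_col_rank_unit. Qed.

Lemma full_rank_proj_sym : (Yp *m Y^T)^T = Yp *m Y^T.
Proof. by rewrite !trmx_mul trmx_inv trmx_mul !trmxK mulmxA. Qed.

Lemma rank_mulmx_stiefel : \rank (U *m Y^T) = r.
Proof.
have Ur : (r <= \rank (U *m Y^T))%N; last first.
  by apply/eqP; rewrite eqn_leq Ur andbT (leq_trans (mxrankM_maxr _ _)) // rank_leq_row.
have YE : Y^T = U^T *m (U *m Y^T) by rewrite mulmxA U_st mul1mx.
by rewrite -[X in (X <= _)%N]Y_full -mxrank_tr {1}YE mxrankM_maxr.
Qed.

(** The curve [(1 + t A) X (1 + t B)] keeps the rank while its outer factors are invertible, and has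
    velocity [A X + X B]; [A] and [B] are chosen to give the two summands. *)
Lemma tangent_rank_intro (P : 'M[R]_(p2, r)) (Q : 'M[R]_(p1, r)) :
  tangent (@rank_r_matrices R p1 p2 r) (U *m Y^T) (U *m P^T + Q *m Y^T).
Proof.
pose A := Q *m U^T; pose B := Yp *m P^T.
pose F (t : R) := 1%:M + t *: A; pose G (t : R) := 1%:M + t *: B.
have FB (n : nat) (M : 'M[R]_n) : Ck_on [set: R] 1 (fun t : R => 1%:M + t *: M).
  by apply: (C1D openT); [exact: (C1_cst openT)|exact: (C1_scalel _ openT)].
have near_u (n : nat) (M : 'M[R]_n) : \forall t \near (0 : R), 1%:M + t *: M \in unitmx.
  apply: near_unitmx; last by rewrite scale0r addr0 unitmx1.
  exact: (C1_continuous (FB _ _)).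
have dF (n : nat) (M : 'M[R]_n) : is_derive (0 : R) (1 : R) (fun t : R => 1%:M + t *: M) M.
  have := is_deriveD (is_derive_cst (1%:M : 'M[R]_n) (0 : R) 1) (is_derive_scalel M 0).
  by rewrite add0r.
apply: (@tangent_intro _ _ _ [set: R] _ _ (fun t => F t *m (U *m Y^T) *m G t)) => //.
- exact: openT.
- by rewrite /F /G !scale0r !addr0 mul1mx mulmx1.
- near=> t; rewrite /rank_r_matrices /= mxrankMfree; last first.
    by rewrite row_free_unit; near: t; exact: near_u.
  have Fu : F t \in unitmx by near: t; exact: near_u.
  by rewrite (eqmxMfull _ _) ?row_full_unit // rank_mulmx_stiefel.
- apply: (C1_mulmx openT); last exact: FB.
  by apply: (C1_mulmx openT); [exact: FB|exact: (C1_cst openT)].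
have cst_d : is_derive (0 : R) (1 : R) (fun=> U *m Y^T) 0 by exact: is_derive_cst.
apply: (is_derive_eq (is_derive_mulmx (is_derive_mulmx (dF _ A) cst_d) (dF _ B))).
rewrite !scale0r !addr0 mulmx0 mul1mx mulmx1 addr0.
rewrite addrC /A /B; congr (_ + _).
  by rewrite -mulmxA [Y^T *m _]mulmxA trmul_full_rank_pinv mul1mx.
by rewrite -mulmxA [U^T *m _]mulmxA U_st mul1mx.
Unshelve. all: by end_near. Qed.

(** Along a rank [r] curve [c], [P c Q] is the product of [P c Yp], the inverse of [U^T c Yp], and
    [U^T c Q]. Both outer factors vanish at [0], so the derivative of the product does too. *)
Lemma tangent_rank_normal v :
  tangent (@rank_r_matrices R p1 p2 r) (U *m Y^T) v ->
  (1%:M - U *m U^T) *m v *m (1%:M - Yp *m Y^T) = 0.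
Proof.
move=> [c [c0 c_rank _ cd]].
set P := 1%:M - U *m U^T; set Q := 1%:M - Yp *m Y^T.
have cst_d (m n : nat) (M : 'M[R]_(m, n)) : is_derive (0 : R) (1 : R) (fun=> M) 0.
  exact: is_derive_cst.
have PcQd : is_derive (0 : R) (1 : R) (fun t => P *m c t *m Q) (P *m v *m Q).
  apply: (is_derive_eq (is_derive_mulmx (is_derive_mulmx (cst_d _ _ P) cd) (cst_d _ _ Q))).
  by rewrite mul0mx add0r mulmx0 addr0.
have Fd := is_derive_mulmx (is_derive_mulmx (cst_d _ _ P) cd) (cst_d _ _ Yp).
have Gd := is_derive_mulmx (is_derive_mulmx (cst_d _ _ U^T) cd) (cst_d _ _ Q).
have Md := is_derive_mulmx (is_derive_mulmx (cst_d _ _ U^T) cd) (cst_d _ _ Yp).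
have M0 : U^T *m c 0 *m Yp = 1%:M.
  by rewrite c0 [U^T *m _]mulmxA U_st mul1mx trmul_full_rank_pinv.
have M0u : U^T *m c 0 *m Yp \in unitmx by rewrite M0 unitmx1.
have Nd := is_derive_invmx Md M0u.
have F0 : P *m c 0 *m Yp = 0.
  have PU : P *m U = 0 by rewrite mulmxBl mul1mx -mulmxA U_st mulmx1 subrr.
  by rewrite c0 [P *m _]mulmxA PU !mul0mx.
have G0 : U^T *m c 0 *m Q = 0.
  rewrite c0 [U^T *m _]mulmxA U_st mul1mx /Q mulmxBr mulmx1 mulmxA trmul_full_rank_pinv.
  by rewrite mul1mx subrr.
have Mc : {for (0 : R), continuous (fun t => U^T *m c t *m Yp)}.
  by apply: differentiable_continuous; apply/derivable1_diffP; case: Md.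
have prodd := is_derive_mulmx (is_derive_mulmx Fd Nd) Gd.
have [_ <-] : is_derive (0 : R) (1 : R) (fun t => P *m c t *m Q) 0.
  apply: (near_eq_is_derive (f := fun t =>
    P *m c t *m Yp *m invmx (U^T *m c t *m Yp) *m (U^T *m c t *m Q))).
    near=> t; rewrite {4}(low_rank_cur (A := U^T) (B := Yp) (C := c t)).
    - by rewrite !mulmxA.
    - by near: t.
    - by near: t; exact: near_unitmx Mc M0u.
  apply: (is_derive_eq prodd).
  by rewrite F0 G0 !mul0mx mulmx0 addr0.
by case: PcQd => _ <-.
Unshelve. all: by end_near. Qed.

Lemma tangent_rankP v : tangent (@rank_r_matrices R p1 p2 r) (U *m Y^T) v <->
  exists P Q, v = U *m P^T + Q *m Y^T.
Proof.
split=> [/tangent_rank_normal|[P [Q ->]]]; last exact: tangent_rank_intro.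
(* Split [v] by the projector [U U^T]; the vanishing normal part says that the complementary piece
   is fixed by right multiplication with [Yp Y^T]. *)
move=> v0; exists (v^T *m U), ((1%:M - U *m U^T) *m v *m Yp).
move: v0; rewrite mulmxBr mulmx1 mulmxA => /subr0_eq <-.
by rewrite trmx_mul trmxK mulmxBl mul1mx mulmxA addrC subrK.
Qed.

End TangentSpace.
End RankManifold.

Lemma invmx_mulmx (R : realType) n (A B : 'M[R]_n) : A \in unitmx -> B \in unitmx ->
  invmx (A *m B) = invmx B *m invmx A.
Proof.
move=> Au Bu; have ABu : A *m B \in unitmx by rewrite unitmx_mul Au.
by apply: (can_inj (mulKmx ABu)); rewrite mulmxV // -mulmxA mulKVmx // mulmxV.
Qed.

(** * Euclidean and Riemannian gradients on the fixed-rank manifold *)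

Section Gradients.
Variables (R : realType) (p1 p2 : nat).

Definition euclidean_gradient (f : 'M[R]_(p1, p2) -> R) (X : 'M[R]_(p1, p2)) :
    'M[R]_(p1, p2) :=
  \matrix_(i, j) 'D_(delta_mx i j) f X.

Lemma derive_euclidean_gradient f X v : differentiable f X ->
  'D_v f X = \tr ((euclidean_gradient f X)^T *m v).
Proof.
move=> fd; rewrite derive_linear_mx // mxtrace_trmul; apply: eq_bigr => i _.
by apply: eq_bigr => j _; rewrite mxE [RHS]mulrC.
Qed.

Lemma C1_euclidean_gradient f : Ck_on [set: 'M[R]_(p1, p2)] 2 f ->
  Ck_on [set: 'M[R]_(p1, p2)] 1 (euclidean_gradient f).
Proof.
move=> [_ fD]; apply/(C1_mxP openT) => i j.
by apply: (C1_eq openT) (fD (delta_mx i j)) => X _; rewrite mxE.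
Qed.

Variable r : nat.

Lemma tangent_rank_linear (X : 'M[R]_(p1, p2)) (c : R) u v : \rank X = r ->
  tangent (@rank_r_matrices R p1 p2 r) X u -> tangent (@rank_r_matrices R p1 p2 r) X v ->
  tangent (@rank_r_matrices R p1 p2 r) X (c *: u + v).
Proof.
move=> /full_rank_factorization[U [Y [U_st Y_full ->]]].
move=> /(tangent_rankP U_st Y_full)[P1 [Q1 ->]] /(tangent_rankP U_st Y_full)[P2 [Q2 ->]].
apply/(tangent_rankP U_st Y_full); exists (c *: P1 + P2), (c *: Q1 + Q2).
rewrite linearP /= mulmxDr mulmxDl -scalemxAr -scalemxAl scalerDr.
by rewrite addrACA.
Qed.

Lemma rank_gradient_unique (X : 'M[R]_(p1, p2)) f w : \rank X = r ->
  tangent (@rank_r_matrices R p1 p2 r) X w ->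
  (forall v, tangent (@rank_r_matrices R p1 p2 r) X v ->
     \tr (w^T *m v) = dalong (@rank_r_matrices R p1 p2 r) f X v) ->
  rgrad (Me r) f X = w.
Proof.
move=> Xr wT wE; apply: xget_subset1; first by split.
move=> w1 w2 [w1T w1E] [w2T w2E]; apply/eqP; rewrite -subr_eq0; apply/eqP.
have dT : tangent (@rank_r_matrices R p1 p2 r) X (w1 - w2).
  by rewrite -[w1 - w2]addrC -scaleN1r; exact: tangent_rank_linear.
apply: mxtrace_trmul_eq0.
rewrite [X in X *m _]linearB /= mulmxBl [LHS]linearB /=.
by move: (w1E _ dT) (w2E _ dT) => /= -> ->; rewrite subrr.
Qed.

(** The first matrix is [G] minus its normal part [P G (1 - S)]. With [P] and [1 - S] symmetric,
    pairing that part with [v] brings out [P v (1 - S)], which is zero for tangent [v]. *)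
Lemma tangent_projection_trace (U : 'M[R]_(p1, r)) (Y : 'M[R]_(p2, r))
    (G v : 'M[R]_(p1, p2)) : stiefel U -> full_col_rank Y ->
  tangent (@rank_r_matrices R p1 p2 r) (U *m Y^T) v ->
  \tr ((U *m U^T *m G + (1%:M - U *m U^T) *m G *m
        (Y *m invmx (Y^T *m Y) *m Y^T))^T *m v) = \tr (G^T *m v).
Proof.
move=> U_st Y_full /(tangent_rank_normal U_st Y_full) v0.
have SS := full_rank_proj_sym Y.
move: (Y *m _ *m _) SS v0 => S SS; set P := 1%:M - U *m U^T => v0.
have -> : U *m U^T *m G + P *m G *m S = G - P *m G *m (1%:M - S).
  rewrite mulmxBr mulmx1 opprB addrCA addrC; congr (_ + _).
  by rewrite /P mulmxBl mul1mx opprB addrC subrK.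
rewrite [X in X *m _]linearB /= mulmxBl [LHS]linearB /= !trmx_mul.
have -> : P^T = P by rewrite /P linearB /= trmx1 trmx_mul trmxK.
have -> : (1%:M - S)^T = 1%:M - S by rewrite linearB /= trmx1 SS.
rewrite -[X in _ - \tr X]mulmxA [X in _ - X]mxtrace_mulC -!mulmxA.
rewrite [P *m _]mulmxA v0.
by rewrite mulmx0 mxtrace0 subr0.
Qed.

Lemma rank_gradientE f (U : 'M[R]_(p1, r)) (Y : 'M[R]_(p2, r)) :
  stiefel U -> full_col_rank Y -> differentiable f (U *m Y^T) ->
  rgrad (Me r) f (U *m Y^T) =
    U *m U^T *m euclidean_gradient f (U *m Y^T) +
    (1%:M - U *m U^T) *m euclidean_gradient f (U *m Y^T) *m
      (Y *m invmx (Y^T *m Y) *m Y^T).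
Proof.
move=> U_st Y_full fd; apply: rank_gradient_unique; first exact: rank_mulmx_stiefel.
  apply/(tangent_rankP U_st Y_full).
  set G := euclidean_gradient _ _.
  exists (G^T *m U), ((1%:M - U *m U^T) *m G *m (Y *m invmx (Y^T *m Y))).
  by rewrite trmx_mul trmxK !mulmxA.
move=> v vT; rewrite (dalongE (Phi := f)) //; last by near=> y.
by rewrite derive_euclidean_gradient // tangent_projection_trace.
Unshelve. all: by end_near. Qed.

Lemma rank_gradientP f (X v : 'M[R]_(p1, p2)) : \rank X = r -> differentiable f X ->
  tangent (@rank_r_matrices R p1 p2 r) X v ->
  \tr ((rgrad (Me r) f X)^T *m v) = \tr ((euclidean_gradient f X)^T *m v).
Proof.
move=> /full_rank_factorization[U [Y [U_st Y_full ->]]] fd vT.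
by rewrite rank_gradientE // tangent_projection_trace.
Qed.

(** The explicit gradient involves factors [U], [Y] that are not given as functions of [X]. Near
    [X0] the columns of [X Y0] and [X^T U0] span the column and row spaces of [X], so projectors
    built from them extend the formula to an open set of matrices. *)
Lemma rank_gradient_field f : Ck_on [set: 'M[R]_(p1, p2)] 2 f ->
  field_on (Me r) 1 (rgrad (Me r) f).
Proof.
move=> f_C2; have fd X : differentiable f X by exact: f_C2.1.
have G1 := C1_euclidean_gradient f_C2; set G := euclidean_gradient f in G1.
split=> [X0 X0r|X Xr|X a Xr ->//]; last first.
  have [U [Y [U_st Y_full XE]]] := full_rank_factorization Xr.
  rewrite XE rank_gradientE // /hor /=; apply/(tangent_rankP U_st Y_full).
  exists ((G (U *m Y^T))^T *m U), ((1%:M - U *m U^T) *m G (U *m Y^T) *m Y *m invmx (Y^T *m Y)).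
  by rewrite trmx_mul trmxK !mulmxA.
have [U0 [Y0 [U0_st Y0_full X0E]]] := full_rank_factorization X0r.
pose M (X : 'M[R]_(p1, p2)) := X *m Y0; pose N (X : 'M[R]_(p1, p2)) := X^T *m U0.
pose proj (p : nat) (Z : 'M[R]_(p, r)) := Z *m invmx (Z^T *m Z) *m Z^T.
have M1 A : open A -> Ck_on A 1 M.
  by move=> Ao; apply: (C1_mulmx Ao); [exact: (C1_id Ao)|exact: (C1_cst Ao)].
have N1 A : open A -> Ck_on A 1 N.
  move=> Ao; apply: (C1_mulmx Ao); last exact: (C1_cst Ao).
  by apply: (C1_trmx Ao); exact: (C1_id Ao).
have gram1 p A (F : 'M[R]_(p1, p2) -> 'M[R]_(p, r)) : open A -> Ck_on A 1 F ->
    Ck_on A 1 (fun X => (F X)^T *m F X).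
  by move=> Ao F1; apply: (C1_mulmx Ao) => //; apply: (C1_trmx Ao).
pose B := [set X | (M X)^T *m M X \in unitmx] `&` [set X | (N X)^T *m N X \in unitmx].
have Bo : open B.
  by apply: openI; apply: open_preimage_unitmx; apply: gram1 => //;
    [exact: openT|exact: (M1 _ openT)|exact: openT|exact: (N1 _ openT)].
have proj1 p (F : 'M[R]_(p1, p2) -> 'M[R]_(p, r)) :
    (forall X, B X -> (F X)^T *m F X \in unitmx) -> Ck_on B 1 F ->
    Ck_on B 1 (fun X => proj p (F X)).
  move=> Fu F1; apply: (C1_mulmx Bo); last exact: (C1_trmx Bo).
  by apply: (C1_mulmx Bo) => //; apply: (C1_invmx Bo) => //; exact: gram1.
(* A projector depends on the column space alone, so any factorization of [X] gives the same
   value. *)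
have projK p (Z : 'M[R]_(p, r)) (K : 'M[R]_r) : Z^T *m Z \in unitmx ->
    (Z *m K)^T *m (Z *m K) \in unitmx -> proj p (Z *m K) = proj p Z.
  move=> Zu ZKu.
  have ZKE : (Z *m K)^T *m (Z *m K) = K^T *m ((Z^T *m Z) *m K) by rewrite trmx_mul !mulmxA.
  have [KTu] : K^T \in unitmx /\ (Z^T *m Z) *m K \in unitmx.
    by apply/andP; rewrite -unitmx_mul -ZKE.
  have Ku : K \in unitmx by rewrite -unitmx_tr.
  rewrite /proj ZKE => _; rewrite !invmx_mulmx // ?unitmx_mul ?Zu //.
  by rewrite trmx_mul -!mulmxA; congr (_ *m _); rewrite mulKVmx // mulKmx.
exists B, (fun X => proj p1 (M X) *m G X + (1%:M - proj p1 (M X)) *m G X *m proj p2 (N X)).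
have GB : Ck_on B 1 G by have [Gd GD] := G1; split=> [X _|v X _]; [exact: Gd|exact: GD].
have PM1 : Ck_on B 1 (fun X => proj p1 (M X)) by apply: proj1 => [X []//|]; exact: M1.
have PN1 : Ck_on B 1 (fun X => proj p2 (N X)) by apply: proj1 => [X []//|]; exact: N1.
have U0U0 : U0^T *m U0 = 1%:M by [].
have Y0u : Y0^T *m Y0 \in unitmx by exact/full_col_rank_unit.
split; first exact: Bo.
- rewrite /B /M /N X0E; split=> /=.
    rewrite !trmx_mul !trmxK -!mulmxA [U0^T *m _]mulmxA U0U0 mul1mx.
    by rewrite mulmxA unitmx_mul Y0u.
  by rewrite !trmx_mul !trmxK -!mulmxA U0U0 mulmx1 [U0^T *m _]mulmxA U0U0 mul1mx.
- apply: (C1D Bo); first exact: (C1_mulmx Bo).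
  apply: (C1_mulmx Bo); last exact: PN1.
  apply: (C1_mulmx Bo); last exact: GB.
  by apply: (C1D Bo); [exact: (C1_cst Bo)|exact: (C1_oppmx Bo)].
move=> X Xr [Mu Nu]; have [U [Y [U_st Y_full XE]]] := full_rank_factorization Xr.
have UU : U^T *m U = 1%:M by [].
have projU : proj p1 U = U *m U^T by rewrite /proj UU invmx1 mulmx1.
have -> : proj p1 (M X) = U *m U^T.
  by rewrite -projU /M XE -mulmxA projK ?UU ?unitmx1 //; move: Mu; rewrite /= /M XE -!mulmxA.
have -> : proj p2 (N X) = proj p2 Y.
  have NE : N X = Y *m (U^T *m U0) by rewrite /N XE trmx_mul trmxK mulmxA.
  rewrite NE projK //; first exact/full_col_rank_unit.
  by move: Nu; rewrite /= NE.
by rewrite {1}XE rank_gradientE // -XE.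
Qed.

(** Infinitesimal action of left and right multiplication by invertible matrices, which preserves
    the rank. *)
Lemma rank_linear_field (A : 'M[R]_p1) (B : 'M[R]_p2) :
  field_on (Me r) 1 (fun X => A *m X + X *m B).
Proof.
split=> [X0 _|X Xr|X a Xr ->//]; last first.
  have [U [Y [U_st Y_full ->]]] := full_rank_factorization Xr.
  apply/(tangent_rankP U_st Y_full); exists (B^T *m Y), (A *m U).
  by rewrite trmx_mul trmxK !mulmxA addrC.
exists [set: 'M[R]_(p1, p2)], (fun X => A *m X + X *m B).
split=> [||| X _ _ //]; [exact: openT|by []|].
have I1 := C1_id (@openT 'M[R]_(p1, p2)).
by apply: (C1D openT); apply: (C1_mulmx openT); by [exact: I1|exact: (C1_cst openT)].
Qed.

End Gradients.

(** * The quotient manifold *)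

Section Quotient.
Variables (R : realType) (p1 p2 r : nat).
Variables V W : 'M[R]_(p2, r) -> 'M[R]_r.
Hypotheses (V_spd : forall Z, full_col_rank Z -> spd (V Z))
           (W_spd : forall Z, full_col_rank Z -> spd (W Z)).
Local Notation E := (factors R p1 p2 r).
Local Notation tot := (@Mq3_total R p1 p2 r).

(* The Cayley transform of a skew matrix [S] with [2 S U = th.1] moves [U] inside
   the Stiefel manifold with velocity [th.1]. *)
Lemma horizontal_tangent (x th : E) : tot x -> x.1^T *m th.1 = 0 -> tangent tot x th.
Proof.
case: x th => [U Y] [a b] [/= U_st Y_full] Ua.
have aU : a^T *m U = 0 by rewrite -[LHS]trmxK trmx_mul trmxK Ua trmx0.
have UU : U^T *m U = 1%:M by [].
pose S := 2^-1 *: (a *m U^T - U *m a^T).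
have S_skew : S^T = - S.
  by rewrite /S linearZ /= linearB /= !trmx_mul !trmxK -scalerN opprB.
have SU : S *m U + S *m U = a.
  have half2 : 2^-1 + 2^-1 = 1 :> R by lra.
  rewrite -mulmxDl /S -scalerDl half2 scale1r mulmxBl -!mulmxA UU aU.
  by rewrite mulmx0 subr0 mulmx1.
clearbody S.
pose F (t : R) := 1%:M + t *: (- S); pose G (t : R) := 1%:M + t *: S.
have FB (n : nat) (M : 'M[R]_n) (B : set R) : open B -> Ck_on B 1 (fun t : R => 1%:M + t *: M).
  by move=> Bo; apply: (C1D Bo); [exact: (C1_cst Bo)|exact: (C1_scalel _ Bo)].
have dF (m n : nat) (C M : 'M[R]_(m, n)) :
    is_derive (0 : R) (1 : R) (fun t : R => C + t *: M) M.
  have := is_deriveD (is_derive_cst C (0 : R) 1) (is_derive_scalel M 0).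
  by rewrite add0r.
pose B := [set t | F t \in unitmx].
have Bo : open B by apply: open_preimage_unitmx; exact: (FB _ _ _ openT).
have F0 : F 0 = 1%:M by rewrite /F scale0r addr0.
have G0 : G 0 = 1%:M by rewrite /G scale0r addr0.
have B0 : B 0 by rewrite /B /= F0 unitmx1.
have c1_d : is_derive (0 : R) (1 : R) (fun t => invmx (F t) *m G t *m U) a.
  have Fd : is_derive (0 : R) (1 : R) F (- S) by exact: dF.
  have Gd : is_derive (0 : R) (1 : R) G S by exact: dF.
  have Fi := is_derive_invmx Fd B0.
  have Ud := is_derive_cst U (0 : R) 1.
  apply: (is_derive_eq (is_derive_mulmx (is_derive_mulmx Fi Gd) Ud)).
  rewrite F0 G0 invmx1 !mul1mx !mulmx1 opprK addr0 mulmxDl.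
  exact: SU.
have Yd : is_derive (0 : R) (1 : R) (fun t : R => Y + t *: b) b by exact: dF.
have c1_C1 : Ck_on B 1 (fun t => invmx (F t) *m G t *m U).
  apply: (C1_mulmx Bo); last exact: (C1_cst Bo).
  apply: (C1_mulmx Bo); last exact: FB.
  by apply: (C1_invmx Bo); [move=> t; exact|exact: FB].
have Y_C1 (A : set R) : open A -> Ck_on A 1 (fun t : R => Y + t *: b).
  by move=> Ao; apply: (C1D Ao); [exact: (C1_cst Ao)|exact: (C1_scalel _ Ao)].
have Y_near : \forall t \near (0 : R), full_col_rank (Y + t *: b).
  have YY1 : Ck_on [set: R] 1 (fun t : R => (Y + t *: b)^T *m (Y + t *: b)).
    by apply: (C1_mulmx openT); [apply: (C1_trmx openT)|]; exact: (Y_C1 _ openT).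
  have : \forall t \near (0 : R), (Y + t *: b)^T *m (Y + t *: b) \in unitmx.
    apply: (near_unitmx (F := fun t : R => (Y + t *: b)^T *m (Y + t *: b))).
      exact: (C1_continuous YY1).
    by rewrite scale0r addr0; exact/full_col_rank_unit.
  by apply: filterS => t /full_col_rank_unit.
apply: (@tangent_intro _ _ _ B _ _ (fun t => (invmx (F t) *m G t *m U, Y + t *: b))) => //.
- by rewrite F0 G0 invmx1 !mul1mx scale0r addr0.
- near=> t; split=> /=; last by near: t.
  have Ft : F t \in unitmx by near: t; exact: open_nbhs_nbhs.
  have GT : (F t)^T = G t.
    by rewrite /F /G linearD /= trmx1 linearZ /= linearN /= S_skew opprK.
  have FT : (G t)^T = F t by rewrite -GT trmxK.
  (* Both are polynomials in [S], hence commute; as they are also transposes of each other, [F^-1 G]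
     is orthogonal. *)
  have FG : F t *m G t = G t *m F t.
    rewrite /F /G scalerN [LHS]mulmxBl [RHS]mulmxBr mul1mx mulmx1; congr (_ - _).
    by rewrite mulmxDr mulmxDl mulmx1 mul1mx.
  have Gu : G t \in unitmx by rewrite -GT unitmx_tr.
  rewrite /stiefel /= !trmx_mul trmx_inv GT FT -!mulmxA.
  rewrite [invmx (G t) *m _]mulmxA -invmx_mulmx // FG invmx_mulmx // !mulmxA.
  by rewrite mulmxK // mulmxKV //.
- by apply: (C1_pair Bo); [exact: c1_C1|exact: Y_C1].
have c1_diff : differentiable (fun t => invmx (F t) *m G t *m U) (0 : R).
  by apply/derivable1_diffP; case: c1_d.
have Y_diff : differentiable (fun t : R => Y + t *: b) (0 : R).
  by apply/derivable1_diffP; case: Yd.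
apply: DeriveDef; first by apply: diff_derivable; exact: differentiable_pair.
by rewrite derive_pair //; case: c1_d => _ ->; case: Yd => _ ->.
Unshelve. all: by end_near. Qed.

Lemma Mq3_horP (x th : E) : tot x -> Mq3_hor x th <-> x.1^T *m th.1 = 0.
Proof. by case=> U_st _; exact: (perp_rangeP _ U_st). Qed.

Lemma Mq3_metric_linear (x th eta zeta : E) (c : R) :
  Mq3_metric V W x (c *: th + eta) zeta =
  c * Mq3_metric V W x th zeta + Mq3_metric V W x eta zeta.
Proof.
have lin q (A B C : 'M[R]_(q, r)) (S : 'M[R]_r) :
    \tr (S *m (c *: A + B)^T *m C) = c * \tr (S *m A^T *m C) + \tr (S *m B^T *m C).
  rewrite [(c *: A + B)^T]linearP /= mulmxDr mulmxDl -scalemxAr -scalemxAl.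
  by rewrite [LHS]linearP.
by rewrite /Mq3_metric /= !lin mulrDr addrACA.
Qed.

Lemma Mq3_metric_sym (x th eta : E) : tot x ->
  Mq3_metric V W x th eta = Mq3_metric V W x eta th.
Proof.
move=> [_ Yf]; rewrite /Mq3_metric; congr (_ + _).
  rewrite -[LHS]mxtrace_tr !trmx_mul trmxK (V_spd Yf).1 mulmxA mxtrace_mulC.
  by rewrite mulmxA.
rewrite -[LHS]mxtrace_tr !trmx_mul trmxK (W_spd Yf).1 mulmxA mxtrace_mulC.
by rewrite mulmxA.
Qed.

Lemma spd_trace_sqrt n (S : 'M[R]_n) m (A : 'M[R]_(m, n)) : spd S ->
  \tr (S *m A^T *m A) = \tr ((A *m spd_sqrt S) *m (A *m spd_sqrt S)^T).
Proof.
move=> S_spd; have [[T_sym _] TT] := spd_sqrtP S_spd.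
by rewrite [LHS]mxtrace_mulC trmx_mul T_sym !mulmxA -(mulmxA A (spd_sqrt S)) TT.
Qed.

Lemma spd_trace_ge0 n (S : 'M[R]_n) m (A : 'M[R]_(m, n)) : spd S ->
  0 <= \tr (S *m A^T *m A).
Proof.
move=> S_spd; rewrite spd_trace_sqrt // mxtrace_mulC.
exact: mxtrace_trmul_ge0.
Qed.

Lemma spd_trace_eq0 n (S : 'M[R]_n) m (A : 'M[R]_(m, n)) : spd S ->
  \tr (S *m A^T *m A) = 0 -> A = 0.
Proof.
move=> S_spd; rewrite spd_trace_sqrt // mxtrace_mulC => /mxtrace_trmul_eq0 AT.
have Tu : spd_sqrt S \in unitmx by apply: spd_unitmx; have [] := spd_sqrtP S_spd.
by apply: (can_inj (mulmxK Tu)); rewrite AT mul0mx.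
Qed.

Lemma Mq3_metric_gt0 (x th : E) : tot x -> th != 0 -> 0 < Mq3_metric V W x th th.
Proof.
move=> [_ Yf] th0; rewrite lt_neqAle /Mq3_metric.
have V0 : 0 <= \tr (V x.2 *m th.1^T *m th.1) by apply: spd_trace_ge0; exact: V_spd.
have W0 : 0 <= \tr (W x.2 *m th.2^T *m th.2) by apply: spd_trace_ge0; exact: W_spd.
rewrite addr_ge0 // andbT eq_sym.
apply: contra_neq th0 => /eqP; rewrite paddr_eq0 //.
move=> /andP[/eqP/(spd_trace_eq0 (V_spd Yf)) th1 /eqP/(spd_trace_eq0 (W_spd Yf)) th2].
by case: th V0 W0 th1 th2 => a b _ _ /= -> ->.
Qed.

Lemma is_derive_factors1 (x th : E) : is_derive x th (fun y : E => y.1) th.1.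
Proof. by apply: is_derive_fst; exact: (C1_differentiable (C1_id openT)). Qed.

Lemma is_derive_factors2 (x th : E) : is_derive x th (fun y : E => y.2) th.2.
Proof. by apply: is_derive_snd; exact: (C1_differentiable (C1_id openT)). Qed.

Lemma is_derive_factors_mul (x th : E) :
  is_derive x th (fun y : E => y.1 *m y.2^T) (Lmap x.1 x.2 th).
Proof.
apply: (is_derive_eq (is_derive_mulmx (is_derive_factors1 x th)
  (is_derive_trmx (is_derive_factors2 x th)))).
by rewrite addrC.
Qed.

Lemma C1_factors1 (A : set E) : open A -> Ck_on A 1 (fun y : E => y.1).
Proof. exact: C1_fst. Qed.

Lemma C1_factors2 (A : set E) : open A -> Ck_on A 1 (fun y : E => y.2).
Proof. exact: C1_snd. Qed.

Lemma C1_factors_mul (A : set E) : open A -> Ck_on A 1 (fun y : E => y.1 *m y.2^T).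
Proof.
move=> Ao; apply: (C1_mulmx Ao); first exact: C1_factors1.
by apply: (C1_trmx Ao); exact: C1_factors2.
Qed.

Lemma differentiable_hr f (x : E) : (forall X, differentiable f X) -> differentiable (hr f) x.
Proof.
move=> fd; apply: (@differentiable_comp _ _ _ _ (fun y : E => y.1 *m y.2^T) f) => //.
exact: (C1_differentiable (C1_factors_mul openT)).
Qed.

Lemma derive_hr f (x th : E) : (forall X, differentiable f X) ->
  'D_th (hr f) x = \tr ((euclidean_gradient f (x.1 *m x.2^T))^T *m Lmap x.1 x.2 th).
Proof.
move=> fd; rewrite -derive_euclidean_gradient //.
have md : differentiable (fun y : E => y.1 *m y.2^T) x.
  exact: (C1_differentiable (C1_factors_mul openT)).
have [_ <-] := is_derive_factors_mul x th.
by have [_ <-] := is_derive_diff_comp th md (fd _).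
Qed.

Lemma Mq3_gradient_unique f (x w : E) : tot x -> Mq3_hor x w ->
  (forall v, Mq3_hor x v -> Mq3_metric V W x w v = dalong tot f x v) ->
  rgrad (Mq3 p1 V W) f x = w.
Proof.
move=> xt wT wE; apply: xget_subset1; first by split.
move=> w1 w2 [w1T w1E] [w2T w2E]; apply/eqP; rewrite -subr_eq0.
apply: contraT => /(Mq3_metric_gt0 xt).
have dT : Mq3_hor x (w1 - w2).
  move: w1T w2T => /(Mq3_horP _ xt) h1 /(Mq3_horP _ xt) h2; apply/(Mq3_horP _ xt).
  by rewrite /= mulmxBr h1 h2 subrr.
have -> : Mq3_metric V W x (w1 - w2) (w1 - w2) =
    -1 * Mq3_metric V W x w2 (w1 - w2) + Mq3_metric V W x w1 (w1 - w2).
  by rewrite -Mq3_metric_linear scaleN1r [- w2 + w1]addrC.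
move: (w1E _ dT) (w2E _ dT) => /= -> ->.
by rewrite mulN1r addNr ltxx.
Qed.

(** The weights of the metric cancel the inverse weights of the lift, and the projector fixes
    [th.1]; no metric is left on the right. *)
Lemma Mq3_metric_lift (x th : E) (G : 'M[R]_(p1, p2)) : tot x -> Mq3_hor x th ->
  Mq3_metric V W x ((1%:M - x.1 *m x.1^T) *m G *m x.2 *m invmx (V x.2),
                    G^T *m x.1 *m invmx (W x.2)) th =
  \tr (G^T *m Lmap x.1 x.2 th).
Proof.
move=> xt th_hor; have Uth := (Mq3_horP th xt).1 th_hor; have [U_st Yf] := xt.
have Vu := spd_unitmx (V_spd Yf); have Wu := spd_unitmx (W_spd Yf).
set P := 1%:M - _.
have PT : P^T = P by rewrite /P linearB /= trmx1 trmx_mul trmxK.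
have Pth : P *m th.1 = th.1 by rewrite /P mulmxBl mul1mx -mulmxA Uth mulmx0 subr0.
rewrite /Mq3_metric /Lmap /= mulmxDr linearD /= addrC; congr (_ + _).
  rewrite !trmx_mul trmx_inv (W_spd Yf).1 trmxK !mulmxA mulmxV // mul1mx.
  rewrite -[LHS]mxtrace_tr trmx_mul trmx_mul trmxK mulmxA mxtrace_mulC mulmxA.
  by rewrite mxtrace_mulC !mulmxA.
rewrite !trmx_mul trmx_inv (V_spd Yf).1 PT !mulmxA mulmxV // mul1mx -!mulmxA Pth.
by rewrite mxtrace_mulC -mulmxA.
Qed.

Lemma Mq3_gradientE f (x : E) : tot x -> (forall X, differentiable f X) ->
  rgrad (Mq3 p1 V W) (hr f) x =
  ((1%:M - x.1 *m x.1^T) *m euclidean_gradient f (x.1 *m x.2^T) *m x.2 *m invmx (V x.2),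
   (euclidean_gradient f (x.1 *m x.2^T))^T *m x.1 *m invmx (W x.2)).
Proof.
move=> xt fd; have UU : x.1^T *m x.1 = 1%:M by case: xt.
apply: Mq3_gradient_unique => //.
  by apply/(Mq3_horP _ xt); rewrite /= !mulmxA mulmxBr mulmx1 mulmxA UU mul1mx subrr !mul0mx.
move=> th th_hor; rewrite (dalongE (Phi := hr f)); first last.
- by near=> y.
- exact: differentiable_hr.
- by apply: horizontal_tangent => //; exact/(Mq3_horP _ xt).
by rewrite derive_hr // Mq3_metric_lift.
Unshelve. all: by end_near. Qed.

Lemma open_full_col_rank : open [set x : E | full_col_rank x.2].
Proof.
rewrite (_ : [set _ | _] = [set x : E | x.2^T *m x.2 \in unitmx]).
  apply: open_preimage_unitmx; apply: (C1_mulmx openT); last exact: C1_factors2 openT.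
  by apply: (C1_trmx openT); exact: C1_factors2 openT.
by apply/seteqP; split=> x /full_col_rank_unit.
Qed.

(** The explicit formula makes sense wherever the second factor has full rank, an open set. It is
    equivariant because [U U^T] and [U Y^T] are constant on orbits and the weight law moves a
    rotation past the inverse weights. *)
Lemma Mq3_gradient_field f : Ck_on [set: 'M[R]_(p1, p2)] 2 f ->
  smooth_on (@full_col_rank R p2 r) V -> smooth_on (@full_col_rank R p2 r) W ->
  (forall Z O, full_col_rank Z -> orthogonal_group O -> V Z = O *m V (Z *m O) *m O^T) ->
  (forall Z O, full_col_rank Z -> orthogonal_group O -> W Z = O *m W (Z *m O) *m O^T) ->
  field_on (Mq3 p1 V W) 1 (rgrad (Mq3 p1 V W) (hr f)).
Proof.
move=> f_C2 V_smooth W_smooth V_equiv W_equiv.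
have fd X : differentiable f X by exact: f_C2.1.
split.
- move=> x0 x0t; have Bo := open_full_col_rank; set B := [set x : E | full_col_rank x.2] in Bo.
  exists B, (fun x : E =>
    ((1%:M - x.1 *m x.1^T) *m euclidean_gradient f (x.1 *m x.2^T) *m x.2 *m invmx (V x.2),
     (euclidean_gradient f (x.1 *m x.2^T))^T *m x.1 *m invmx (W x.2))).
  have U1 := C1_factors1 Bo; have Y1 := C1_factors2 Bo.
  have G1 : Ck_on B 1 (fun x : E => euclidean_gradient f (x.1 *m x.2^T)).
    apply: (C1_comp_mx Bo (B := setT)); [by []|exact: C1_factors_mul|].
    exact: C1_euclidean_gradient.
  have weight1 (S : 'M[R]_(p2, r) -> 'M[R]_r) : smooth_on (@full_col_rank R p2 r) S ->
      (forall Z, full_col_rank Z -> spd (S Z)) -> Ck_on B 1 (fun x : E => invmx (S x.2)).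
    move=> S_smooth S_spd; apply: (C1_invmx Bo) => [x Bx|]; first exact/spd_unitmx/S_spd.
    apply: (C1_comp_mx Bo (B := @full_col_rank R p2 r)); [by []|exact: Y1|].
    exact: S_smooth 1%N.
  split; [exact: Bo|by case: x0t|apply: (C1_pair Bo)|].
  + apply: (C1_mulmx Bo); last exact: weight1.
    apply: (C1_mulmx Bo); last exact: Y1.
    apply: (C1_mulmx Bo); last exact: G1.
    apply: (C1D Bo); first exact: (C1_cst Bo).
    apply: (C1_oppmx Bo); apply: (C1_mulmx Bo); first exact: U1.
    by apply: (C1_trmx Bo); exact: U1.
  + apply: (C1_mulmx Bo); last exact: weight1.
    by apply: (C1_mulmx Bo); [apply: (C1_trmx Bo); exact: G1|exact: U1].
  by move=> x xt _; rewrite Mq3_gradientE.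
- move=> x xt; rewrite Mq3_gradientE //; apply/(Mq3_horP _ xt) => /=.
  have UU : x.1^T *m x.1 = 1%:M by case: xt.
  by rewrite !mulmxA mulmxBr mulmx1 mulmxA UU mul1mx subrr !mul0mx.
move=> x a xt [P O_orth ->]; have [U_st Yf] := xt.
have UU : x.1^T *m x.1 = 1%:M by [].
have OO : P^T *m P = 1%:M by [].
have OOT : P *m P^T = 1%:M by exact: mulmx1C.
have YOf : full_col_rank (x.2 *m P).
  rewrite /full_col_rank /= mxrankMfree // row_free_unit.
  by have [] := mulmx1_unit OO.
have xOt : tot (x.1 *m P, x.2 *m P).
  split=> //=; rewrite /stiefel /= trmx_mul mulmxA -(mulmxA (P^T)) UU mulmx1.
  exact: OO.
have equiv_inv (S : 'M[R]_(p2, r) -> 'M[R]_r) :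
    (forall Z, full_col_rank Z -> spd (S Z)) ->
    (forall Z O, full_col_rank Z -> orthogonal_group O -> S Z = O *m S (Z *m O) *m O^T) ->
    P *m invmx (S (x.2 *m P)) = invmx (S x.2) *m P.
  move=> S_spd S_equiv.
  have Su := spd_unitmx (S_spd _ YOf); have Su' := spd_unitmx (S_spd _ Yf).
  apply: (can_inj (mulKmx Su')); rewrite mulKVmx // (S_equiv _ P) //.
  by rewrite -!mulmxA [P^T *m _]mulmxA OO mul1mx mulmxV ?mulmx1.
rewrite !Mq3_gradientE //= !trmx_mul.
have -> : x.1 *m P *m (P^T *m x.1^T) = x.1 *m x.1^T by rewrite mulmxA -(mulmxA x.1) OOT mulmx1.
have -> : x.1 *m P *m (P^T *m x.2^T) = x.1 *m x.2^T by rewrite mulmxA -(mulmxA x.1) OOT mulmx1.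
by congr (_, _); rewrite -!mulmxA equiv_inv // !mulmxA.
Qed.

(** Constant matrices multiply from the left and so commute with the right action of the orthogonal
    group; the projector makes the first component horizontal and is itself invariant. *)
Lemma Mq3_polynomial_field (A : 'M[R]_(p1, p2)) (B : 'M[R]_(p2, p1)) :
  field_on (Mq3 p1 V W) 1
    (fun x : E => ((1%:M - x.1 *m x.1^T) *m A *m x.2, B *m x.1)).
Proof.
split.
- move=> x0 _; have To := @openT E.
  exists setT, (fun x : E => ((1%:M - x.1 *m x.1^T) *m A *m x.2, B *m x.1)).
  have U1 := C1_factors1 To; have Y1 := C1_factors2 To.
  split; [exact: To|by []|apply: (C1_pair To)|by []].
  + apply: (C1_mulmx To); last exact: Y1.
    apply: (C1_mulmx To); last exact: (C1_cst To).
    apply: (C1D To); first exact: (C1_cst To).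
    apply: (C1_oppmx To); apply: (C1_mulmx To); first exact: U1.
    by apply: (C1_trmx To); exact: U1.
  + by apply: (C1_mulmx To); [exact: (C1_cst To)|exact: U1].
- move=> x xt; apply/(Mq3_horP _ xt) => /=.
  have UU : x.1^T *m x.1 = 1%:M by case: xt.
  by rewrite !mulmxA mulmxBr mulmx1 mulmxA UU mul1mx subrr !mul0mx.
move=> x a xt [P O_orth ->] /=.
have OOT : P *m P^T = 1%:M by exact: mulmx1C.
congr (_, _); last by rewrite mulmxA.
have -> : x.1 *m P *m (x.1 *m P)^T = x.1 *m x.1^T.
  by rewrite trmx_mul mulmxA -(mulmxA x.1) OOT mulmx1.
by rewrite !mulmxA.
Qed.

End Quotient.

(** * Hessians at a stationary point *)

Section Hessians.
Variables (R : realType) (p1 p2 r : nat).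
Local Notation E := (factors R p1 p2 r).
Local Notation tot := (@Mq3_total R p1 p2 r).
Variable f : 'M[R]_(p1, p2) -> R.
Hypothesis f_C2 : Ck_on [set: 'M[R]_(p1, p2)] 2 f.
Let G := euclidean_gradient f.

(* The common value of both Hessian forms at a stationary point. *)
Definition lifted_hessian (x v w : E) : R :=
  \tr (('D_(Lmap x.1 x.2 v) G (x.1 *m x.2^T))^T *m Lmap x.1 x.2 w) +
  \tr ((G (x.1 *m x.2^T))^T *m (v.1 *m w.2^T + w.1 *m v.2^T)).

Let fd X : differentiable f X. Proof. exact: f_C2.1. Qed.

Let Gd X : differentiable G X.
Proof. exact: (C1_differentiable (C1_euclidean_gradient f_C2)). Qed.

Lemma trace_tangent_null (x : E) (P : 'M[R]_(r, p2)) (Q : 'M[R]_(p1, r)) :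
  (G (x.1 *m x.2^T))^T *m x.1 = 0 -> G (x.1 *m x.2^T) *m x.2 = 0 ->
  \tr ((G (x.1 *m x.2^T))^T *m (x.1 *m P)) = 0 /\
  \tr ((G (x.1 *m x.2^T))^T *m (Q *m x.2^T)) = 0.
Proof.
move=> GU GY; split; first by rewrite mulmxA GU mul0mx mxtrace0.
by rewrite mulmxA mxtrace_mulC mulmxA -trmx_mul GY trmx0 mul0mx mxtrace0.
Qed.

Lemma Mq3_hessianE (V W : 'M[R]_(p2, r) -> 'M[R]_r)
    (nabla : (E -> E) -> E -> E -> E) (x v w : E) :
  (forall Z, full_col_rank Z -> spd (V Z)) ->
  (forall Z, full_col_rank Z -> spd (W Z)) ->
  field_on (Mq3 p1 V W) 1 (rgrad (Mq3 p1 V W) (hr f)) ->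
  levi_civita (Mq3 p1 V W) nabla -> tot x ->
  rgrad (Mq3 p1 V W) (hr f) x = 0 ->
  (G (x.1 *m x.2^T))^T *m x.1 = 0 -> G (x.1 *m x.2^T) *m x.2 = 0 ->
  Mq3_hor x v -> Mq3_hor x w ->
  Mq3_metric V W x (nabla (rgrad (Mq3 p1 V W) (hr f)) x v) w = lifted_hessian x v w.
Proof.
move=> V_spd W_spd grad_field LC xt grad0 GU GY v_hor w_hor.
have [U_st Yf] := xt; have UU : x.1^T *m x.1 = 1%:M by [].
have Uw := (Mq3_horP w xt).1 w_hor; have Uv := (Mq3_horP v xt).1 v_hor.
(* These choices give [A Y = w.1], which the projector fixes, and [B U = w.2]: the field takes the
   value [w] at [x]. *)
pose A := w.1 *m invmx (x.2^T *m x.2) *m x.2^T; pose B := w.2 *m x.1^T.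
pose z1 (y : E) := (1%:M - y.1 *m y.1^T) *m A *m y.2; pose z2 (y : E) := B *m y.1.
have zeta_field : field_on (Mq3 p1 V W) 1 (fun y : E => (z1 y, z2 y)).
  exact: Mq3_polynomial_field.
have z1x : z1 x = w.1.
  rewrite /z1 /A -!mulmxA mulVmx; last exact/full_col_rank_unit.
  by rewrite mulmx1 mulmxBl mul1mx -mulmxA Uw mulmx0 subr0.
have z2x : z2 x = w.2 by rewrite /z2 /B -mulmxA UU mulmx1.
have wE : (z1 x, z2 x) = w by rewrite z1x z2x; case: (w).
have lc := lc_metric LC grad_field zeta_field xt v_hor.
move: lc; rewrite wE grad0.
have metric0 u : Mq3_metric V W x 0 u = 0.
  by rewrite /Mq3_metric !trmx0 !mulmx0 !mul0mx !mxtrace0 addr0.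
rewrite /= metric0 addr0 => <-.
(* The pairing of the gradient with the field, written without the metric so that it is C^1 on the
   whole ambient space. *)
pose Psi (y : E) := \tr ((G (y.1 *m y.2^T))^T *m (y.1 *m (z2 y)^T + z1 y *m y.2^T)).
have U1 := C1_factors1 (@openT E); have Y1 := C1_factors2 (@openT E).
have z1C1 : Ck_on [set: E] 1 z1.
  apply: (C1_mulmx openT); last exact: Y1.
  apply: (C1_mulmx openT); last exact: (C1_cst openT).
  apply: (C1D openT); first exact: (C1_cst openT).
  apply: (C1_oppmx openT); apply: (C1_mulmx openT); first exact: U1.
  by apply: (C1_trmx openT); exact: U1.
have z2C1 : Ck_on [set: E] 1 z2.
  by apply: (C1_mulmx openT); [exact: (C1_cst openT)|exact: U1].
have z1d := differentiable_is_derive v (C1_differentiable z1C1 (I : [set: E] x)).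
have z2d := differentiable_is_derive v (C1_differentiable z2C1 (I : [set: E] x)).
have Gxd : is_derive x v (fun y : E => G (y.1 *m y.2^T))
    ('D_(Lmap x.1 x.2 v) G (x.1 *m x.2^T)).
  have md : differentiable (fun y : E => y.1 *m y.2^T) x.
    exact: (C1_differentiable (C1_factors_mul openT)).
  have [_ <-] := is_derive_factors_mul x v.
  exact: is_derive_diff_comp.
have term1 := is_derive_mulmx (is_derive_factors1 x v) (is_derive_trmx z2d).
have term2 := is_derive_mulmx z1d (is_derive_trmx (is_derive_factors2 x v)).
have Psid := is_derive_mxtrace (is_derive_mulmx (is_derive_trmx Gxd) (is_deriveD term1 term2)).
have Psi_diff : differentiable Psi x.
  apply: (C1_differentiable (A := setT)) => //; apply: (C1_mxtrace openT).
  apply: (C1_mulmx openT).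
    apply: (C1_trmx openT).
    apply: (C1_comp_mx openT (B := setT)); [by []|exact: C1_factors_mul openT|].
    exact: C1_euclidean_gradient.
  apply: (C1D openT); apply: (C1_mulmx openT).
  - exact: U1.
  - by apply: (C1_trmx openT); exact: z2C1.
  - exact: z1C1.
  - by apply: (C1_trmx openT); exact: Y1.
rewrite (dalongE (Phi := Psi)) //.
- have [_ ->] := Psid.
  rewrite -/G z1x z2x linearD /= /lifted_hessian; congr (_ + _).
    by rewrite /Lmap -z1x -z2x.
  (* The derivatives of the extension occur only as [x.1 *m _] and [_ *m x.2^T], so the result does
     not depend on how [w] was extended. *)
  have [null1 _] := trace_tangent_null ('D_v z2 x)^T 0 GU GY.
  have [_ null2] := trace_tangent_null 0 ('D_v z1 x) GU GY.
  by rewrite !mulmxDr !linearD /= null1 null2 addr0 add0r.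
- by apply: horizontal_tangent.
near=> y; move=> yt.
have z_hor : Mq3_hor y (z1 y, z2 y) by have [_ + _] := zeta_field; exact.
by rewrite Mq3_gradientE // Mq3_metric_lift.
Unshelve. all: by end_near. Qed.

Lemma rank_hessianE (nabla : ('M[R]_(p1, p2) -> 'M[R]_(p1, p2)) ->
      'M[R]_(p1, p2) -> 'M[R]_(p1, p2) -> 'M[R]_(p1, p2)) (x v w : E) :
  levi_civita (Me r) nabla -> tot x ->
  rgrad (Me r) f (x.1 *m x.2^T) = 0 ->
  (G (x.1 *m x.2^T))^T *m x.1 = 0 -> G (x.1 *m x.2^T) *m x.2 = 0 ->
  Mq3_hor x v -> Mq3_hor x w ->
  \tr ((nabla (rgrad (Me r) f) (x.1 *m x.2^T) (Lmap x.1 x.2 v))^T *m Lmap x.1 x.2 w) =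
  lifted_hessian x v w.
Proof.
move=> LC xt grad0 GU GY v_hor w_hor.
have [U_st Yf] := xt; have UU : x.1^T *m x.1 = 1%:M by [].
have Uw := (Mq3_horP w xt).1 w_hor; have Uv := (Mq3_horP v xt).1 v_hor.
set X := x.1 *m x.2^T in grad0 GU GY *.
have Xr : \rank X = r by exact: rank_mulmx_stiefel.
pose Yp := x.2 *m invmx (x.2^T *m x.2).
have YYp : x.2^T *m Yp = 1%:M by exact: trmul_full_rank_pinv.
clearbody Yp.
pose A := w.1 *m x.1^T; pose B := Yp *m w.2^T.
have zeta_field : field_on (Me r) 1 (fun Z : 'M[R]_(p1, p2) => A *m Z + Z *m B).
  exact: rank_linear_field.
have LT u : tangent (@rank_r_matrices R p1 p2 r) X (Lmap x.1 x.2 u).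
  by apply/tangent_rankP => //; exists u.2, u.1.
have wE : A *m X + X *m B = Lmap x.1 x.2 w.
  rewrite /A /B /X /Lmap addrC; congr (_ + _).
    by rewrite -mulmxA [x.2^T *m _]mulmxA YYp mul1mx.
  by rewrite -mulmxA [x.1^T *m _]mulmxA UU mul1mx.
have := lc_metric LC (rank_gradient_field r f_C2) zeta_field Xr (LT v).
rewrite /= wE grad0 trmx0 mul0mx mxtrace0 addr0 => <-.
pose Phi (Z : 'M[R]_(p1, p2)) := \tr ((G Z)^T *m (A *m Z + Z *m B)).
have I1 := C1_id (@openT 'M[R]_(p1, p2)).
have Phi_diff : differentiable Phi X.
  apply: (C1_differentiable (A := setT)) => //; apply: (C1_mxtrace openT).
  apply: (C1_mulmx openT); first by apply: (C1_trmx openT); exact: C1_euclidean_gradient.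
  by apply: (C1D openT); apply: (C1_mulmx openT); by [exact: I1|exact: (C1_cst openT)].
rewrite (dalongE (Phi := Phi)) //; last first.
  near=> Z; move=> Zr; rewrite rank_gradientP //.
  by have [_ + _] := zeta_field; exact.
have Gxd := differentiable_is_derive (Lmap x.1 x.2 v) (Gd X).
have idd : is_derive X (Lmap x.1 x.2 v) (fun Z => Z) (Lmap x.1 x.2 v) by exact: is_derive_id.
have term1 := is_derive_mulmx (is_derive_cst A X (Lmap x.1 x.2 v)) idd.
have term2 := is_derive_mulmx idd (is_derive_cst B X (Lmap x.1 x.2 v)).
have Phid := is_derive_mxtrace (is_derive_mulmx (is_derive_trmx Gxd) (is_deriveD term1 term2)).
have [_ ->] := Phid.
rewrite -/G /cst mul0mx mulmx0 add0r addr0 -[(_ + _) X]/(A *m X + X *m B) wE.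
rewrite linearD /= /lifted_hessian -/X; congr (_ + _).
(* Of the four terms, one vanishes by horizontality of [v] and one by stationarity; the other two
   are the second-order part of [lifted_hessian]. *)
rewrite /Lmap !mulmxDr !mulmxDl !linearD /=.
have AU : A *m (x.1 *m v.2^T) = w.1 *m v.2^T.
  by rewrite /A -mulmxA [x.1^T *m _]mulmxA UU mul1mx.
have AY : A *m (v.1 *m x.2^T) = 0.
  by rewrite /A -mulmxA [x.1^T *m _]mulmxA Uv mul0mx mulmx0.
have BY : v.1 *m x.2^T *m B = v.1 *m w.2^T.
  by rewrite /B -mulmxA [x.2^T *m _]mulmxA YYp mul1mx.
have [null1 _] := trace_tangent_null (v.2^T *m B) 0 GU GY.
rewrite AU AY BY mulmx0 mxtrace0 addr0 -(mulmxA x.1) null1 add0r.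
by rewrite addrC.
Unshelve. all: by end_near. Qed.

(** At a stationary point the form at [(a, b)] is the iterated derivative of [f] along fields
    extending [b] and then [a]. By torsion-freeness, exchanging the two changes it by the derivative
    of [f] along a tangent vector, which is zero. *)
Lemma rank_hessian_sym (nabla : ('M[R]_(p1, p2) -> 'M[R]_(p1, p2)) ->
      'M[R]_(p1, p2) -> 'M[R]_(p1, p2) -> 'M[R]_(p1, p2)) (X a b : 'M[R]_(p1, p2)) :
  levi_civita (Me r) nabla -> \rank X = r ->
  rgrad (Me r) f X = 0 ->
  tangent (@rank_r_matrices R p1 p2 r) X a ->
  tangent (@rank_r_matrices R p1 p2 r) X b ->
  \tr ((nabla (rgrad (Me r) f) X a)^T *m b) = \tr ((nabla (rgrad (Me r) f) X b)^T *m a).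
Proof.
move=> LC Xr grad0 aT bT.
have ext u : tangent (@rank_r_matrices R p1 p2 r) X u -> exists A B, u = A *m X + X *m B.
  have [U [Y [U_st Y_full XE]]] := full_rank_factorization Xr.
  rewrite XE => /(tangent_rankP U_st Y_full)[P [Q ->]].
  exists (Q *m U^T), (Y *m invmx (Y^T *m Y) *m P^T).
  rewrite -!mulmxA [U^T *m _]mulmxA U_st mul1mx [Y^T *m (Y *m _)]mulmxA.
  by rewrite mulKVmx 1?addrC //; exact/full_col_rank_unit.
have [Aa [Ba aE]] := ext _ aT; have [Ab [Bb bE]] := ext _ bT.
pose xi (Z : 'M[R]_(p1, p2)) := Aa *m Z + Z *m Ba.
pose eta (Z : 'M[R]_(p1, p2)) := Ab *m Z + Z *m Bb.
have xi_field : field_on (Me r) 1 xi by exact: rank_linear_field.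
have eta_field : field_on (Me r) 1 eta by exact: rank_linear_field.
have f_function : function_on (Me r) 2 f.
  split=> [Z Zr|Z g _ ->//]; exists setT, f.
  by split; [exact: openT|by []|exact: f_C2|].
have grad_field := rank_gradient_field r f_C2.
have form (zeta : 'M[R]_(p1, p2) -> 'M[R]_(p1, p2)) u :
    field_on (Me r) 1 zeta -> Ck_on [set: 'M[R]_(p1, p2)] 1 zeta ->
    tangent (@rank_r_matrices R p1 p2 r) X u ->
    \tr ((nabla (rgrad (Me r) f) X u)^T *m zeta X) =
    dalong (@rank_r_matrices R p1 p2 r)
      (fun y => dalong (@rank_r_matrices R p1 p2 r) f y (zeta y)) X u.
  move=> zeta_field zetaC1 uT.
  have := lc_metric LC grad_field zeta_field Xr uT.
  rewrite /= grad0 trmx0 mul0mx mxtrace0 addr0 => <-.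
  pose Phi (Z : 'M[R]_(p1, p2)) := \tr ((G Z)^T *m zeta Z).
  have Phi_diff : differentiable Phi X.
    apply: (C1_differentiable (A := setT)) => //; apply: (C1_mxtrace openT).
    apply: (C1_mulmx openT); last exact: zetaC1.
    by apply: (C1_trmx openT); exact: C1_euclidean_gradient.
  have zetaT Z : \rank Z = r -> tangent (@rank_r_matrices R p1 p2 r) Z (zeta Z).
    by have [_ + _] := zeta_field; exact.
  rewrite !(dalongE (Phi := Phi)) //.
    by near=> Z; move=> Zr; rewrite rank_gradientP //; exact: zetaT.
  near=> Z; move=> Zr; rewrite (dalongE (Phi := f)) ?derive_euclidean_gradient //.
    exact: zetaT.
  by near=> Z'.
have I1 := C1_id (@openT 'M[R]_(p1, p2)).
have linC1 A B : Ck_on [set: 'M[R]_(p1, p2)] 1 (fun Z : 'M[R]_(p1, p2) => A *m Z + Z *m B).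
  by apply: (C1D openT); apply: (C1_mulmx openT); by [exact: I1|exact: (C1_cst openT)].
have := lc_torsion_free LC xi_field eta_field f_function Xr.
have xiX : xi X = a by rewrite aE.
have etaX : eta X = b by rewrite bE.
rewrite xiX etaX /= -(form eta a eta_field (linC1 Ab Bb) aT).
rewrite -(form xi b xi_field (linC1 Aa Ba) bT) xiX etaX.
set u := nabla eta X a - nabla xi X b.
have uT : tangent (@rank_r_matrices R p1 p2 r) X u.
  rewrite /u -[_ - _]addrC -scaleN1r; apply: tangent_rank_linear => //.
    by have := lc_hor LC xi_field Xr bT.
  by have := lc_hor LC eta_field Xr aT.
rewrite (dalongE (Phi := f)) //; last by near=> Z.
rewrite derive_euclidean_gradient // -(rank_gradientP Xr (fd X) uT) grad0.
rewrite trmx0 mul0mx mxtrace0.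
by move=> /esym/subr0_eq.
Unshelve. all: by end_near. Qed.

End Hessians.

(** * Comparison of the two metrics through [Lmap] *)

Section LiftedMetric.
Variables (R : realType) (p1 p2 r : nat).
Local Notation E := (factors R p1 p2 r).
Variables V W : 'M[R]_(p2, r) -> 'M[R]_r.
Hypotheses (V_spd : forall Z, full_col_rank Z -> spd (V Z))
           (W_spd : forall Z, full_col_rank Z -> spd (W Z)).

Lemma Lmap_sqnorm (U : 'M[R]_(p1, r)) (Y : 'M[R]_(p2, r)) (th : E) :
  U^T *m U = 1%:M -> U^T *m th.1 = 0 ->
  \tr ((Lmap U Y th)^T *m Lmap U Y th) =
  \tr (th.1 *m (Y^T *m Y) *m th.1^T) + \tr (th.2^T *m th.2).
Proof.
move=> UU Uth; have thU : th.1^T *m U = 0 by rewrite -[LHS]trmxK trmx_mul trmxK Uth trmx0.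
rewrite /Lmap [X in X *m _]linearD /= !trmx_mul !trmxK mulmxDl !mulmxDr.
have -> : th.2 *m U^T *m (U *m th.2^T) = th.2 *m th.2^T.
  by rewrite -mulmxA [U^T *m _]mulmxA UU mul1mx.
have -> : th.2 *m U^T *m (th.1 *m Y^T) = 0.
  by rewrite -mulmxA [U^T *m _]mulmxA Uth mul0mx mulmx0.
have -> : Y *m th.1^T *m (U *m th.2^T) = 0.
  by rewrite -mulmxA [th.1^T *m _]mulmxA thU mul0mx mulmx0.
rewrite addr0 add0r linearD /= addrC mxtrace_mulC; congr (_ + _).
  by rewrite !mulmxA.
exact: mxtrace_mulC.
Qed.

(** Origin of the constants: the substitution [th.1 V^(1/2)] turns the form [Y^T Y] into the Gram
    matrix of [Y V^(-1/2)], and [th.2 W^(1/2)] turns the identity into [W^-1]; each weighted term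
    becomes a plain squared norm. *)
Lemma Lmap_sqnorm_bounds (U : 'M[R]_(p1, r)) (Y : 'M[R]_(p2, r)) (th : E) :
  (0 < r <= p2)%N -> full_col_rank Y -> U^T *m U = 1%:M -> U^T *m th.1 = 0 ->
  Num.min (sigma r (invmx (W Y))) (sigma r (Y *m invmx (spd_sqrt (V Y))) ^+ 2)
    * Mq3_metric V W (U, Y) th th
    <= \tr ((Lmap U Y th)^T *m Lmap U Y th) <=
  Num.max (sigma 1 (invmx (W Y))) (sigma 1 (Y *m invmx (spd_sqrt (V Y))) ^+ 2)
    * Mq3_metric V W (U, Y) th th.
Proof.
move=> r_bounds Yf UU Uth; set s1 := sigma 1 (Y *m _) ^+ 2; set sr := sigma r (Y *m _) ^+ 2.
rewrite Lmap_sqnorm // /Mq3_metric /=.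
have [r_gt0 r_le] := andP r_bounds.
have V0 := spd_trace_ge0 th.1 (V_spd Yf); have W0 := spd_trace_ge0 th.2 (W_spd Yf).
have boundV : sr * \tr (V Y *m th.1^T *m th.1) <= \tr (th.1 *m (Y^T *m Y) *m th.1^T)
    <= s1 * \tr (V Y *m th.1^T *m th.1).
  have [T_spd TT] := spd_sqrtP (V_spd Yf); have Tu := spd_unitmx T_spd.
  have := sigma_sqr_bounds (Y *m invmx (spd_sqrt (V Y))) (th.1 *m spd_sqrt (V Y)) r_bounds.
  rewrite -spd_trace_sqrt; last exact: V_spd.
  rewrite (_ : _ *m _ *m (_ *m _)^T = th.1 *m (Y^T *m Y) *m th.1^T) //.
  rewrite !trmx_mul trmx_inv T_spd.1 !mulmxA mulmxK // -!mulmxA.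
  by rewrite mulKmx // !mulmxA.
have boundW : sigma r (invmx (W Y)) * \tr (W Y *m th.2^T *m th.2) <= \tr (th.2^T *m th.2)
    <= sigma 1 (invmx (W Y)) * \tr (W Y *m th.2^T *m th.2).
  have [T_spd TT] := spd_sqrtP (W_spd Yf); have Tu := spd_unitmx T_spd.
  have := sigma_spd_bounds (th.2 *m spd_sqrt (W Y)) r_gt0 (spd_invmx (W_spd Yf)).
  rewrite -spd_trace_sqrt; last exact: W_spd.
  rewrite (_ : _ *m _ *m (_ *m _)^T = th.2 *m th.2^T) ?(mxtrace_mulC th.2) //.
  have -> : invmx (W Y) = invmx (spd_sqrt (W Y)) *m invmx (spd_sqrt (W Y)).
    by rewrite -invmx_mulmx // TT.
  by rewrite trmx_mul T_spd.1 !mulmxA mulmxK // -!mulmxA mulKmx.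
move: boundV boundW => /andP[Vl Vr] /andP[Wl Wr].
rewrite !mulrDr; apply/andP; split; apply: lerD.
- by apply: le_trans Vl; apply: ler_wpM2r => //; rewrite ge_min lexx orbT.
- by apply: le_trans Wl; apply: ler_wpM2r => //; rewrite ge_min lexx.
- by apply: le_trans Vr _; apply: ler_wpM2r => //; rewrite le_max lexx orbT.
- by apply: le_trans Wr _; apply: ler_wpM2r => //; rewrite le_max lexx.
Qed.

End LiftedMetric.

(** * Assembly in linear coordinates on the horizontal space *)

Theorem theorem7 (R : realType) (p1 p2 r : nat) (f : 'M[R]_(p1, p2) -> R)
    (V W : 'M[R]_(p2, r) -> 'M[R]_r) (U : 'M[R]_(p1, r)) (Y : 'M[R]_(p2, r))
    (r_gt0 : (1 <= r)%N) (r_le : (r <= minn p1 p2)%N)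
    (f_C2 : Ck_on [set: 'M[R]_(p1, p2)] 2 f)
    (V_smooth : smooth_on (@full_col_rank R p2 r) V)
    (W_smooth : smooth_on (@full_col_rank R p2 r) W)
    (V_spd : forall Z, full_col_rank Z -> spd (V Z))
    (W_spd : forall Z, full_col_rank Z -> spd (W Z))
    (V_equiv : forall Z O, full_col_rank Z -> orthogonal_group O ->
       V Z = O *m V (Z *m O) *m O^T)
    (W_equiv : forall Z O, full_col_rank Z -> orthogonal_group O ->
       W Z = O *m W (Z *m O) *m O^T)
    (U_stiefel : stiefel U) (Y_full : full_col_rank Y) :
  let X := U *m Y^T in
  let x : factors R p1 p2 r := (U, Y) in
  let gradf := rgrad (Me r) f X in
  let gradh := rgrad (Mq3 p1 V W) (hr f) x in
  [/\ gradf = gradh.1 *m V Y *m moore_penrose Y + (gradh.2 *m W Y *m U^T)^T,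
      gradh = (proj_perp U *m gradf *m Y *m invmx (V Y),
               gradf^T *m U *m invmx (W Y)) &
      gradh = 0 ->
      forall nabla_e nabla_q,
        levi_civita (Me r) nabla_e -> levi_civita (Mq3 p1 V W) nabla_q ->
        let Hf := rhess (Me r) nabla_e f X in
        let Hh := rhess (Mq3 p1 V W) nabla_q (hr f) x in
        let Te := hor (Me r) X in
        let Tq := hor (Mq3 p1 V W) x in
        let d := ((p1 + p2 - r) * r)%N in
        [/\ forall th, Tq th ->
              rhess_form (Mq3 p1 V W) nabla_q (hr f) x th th =
              rhess_form (Me r) nabla_e f X (Lmap U Y th) (Lmap U Y th),
            size (op_eigenvalues Tq Hh) = d &
            forall i, (1 <= i <= d)%N ->
              sandwiched (lambda i Tq Hh)
                (Num.min (sigma r (invmx (W Y)))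
                         (sigma r (Y *m invmx (spd_sqrt (V Y))) ^+ 2)
                 * lambda i Te Hf)
                (Num.max (sigma 1 (invmx (W Y)))
                         (sigma 1 (Y *m invmx (spd_sqrt (V Y))) ^+ 2)
                 * lambda i Te Hf)]].
Proof.
move=> X x gradf gradh.
have UU : U^T *m U = 1%:M by [].
have xt : Mq3_total x by split.
have fd Z : differentiable f Z by exact: f_C2.1.
have Yu : Y^T *m Y \in unitmx by exact/full_col_rank_unit.
have Vu := spd_unitmx (V_spd _ Y_full); have Wu := spd_unitmx (W_spd _ Y_full).
pose G := euclidean_gradient f X; pose P := 1%:M - U *m U^T.
have [S SE] : exists S, S = Y *m invmx (Y^T *m Y) *m Y^T by eexists.
have gradfE : gradf = U *m U^T *m G + P *m G *m S.
  by rewrite SE; exact: rank_gradientE.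
have gradhE : gradh = (P *m G *m Y *m invmx (V Y), G^T *m U *m invmx (W Y)).
  exact: Mq3_gradientE.
have PU : P *m U = 0 by rewrite mulmxBl mul1mx -mulmxA UU mulmx1 subrr.
have UP : U^T *m P = 0 by rewrite mulmxBr mulmx1 mulmxA UU mul1mx subrr.
have PP : P *m P = P by rewrite {2}/P mulmxBr mulmx1 mulmxA PU mul0mx subr0.
have SY : S *m Y = Y by rewrite SE -!mulmxA mulVmx // mulmx1.
have Ugradf : U^T *m gradf = U^T *m G.
  by rewrite gradfE mulmxDr !mulmxA UU mul1mx UP !mul0mx addr0.
have PgradfY : P *m gradf *m Y = P *m G *m Y.
  rewrite gradfE mulmxDr !mulmxA PU !mul0mx add0r PP.
  by rewrite -[_ *m S *m Y]mulmxA SY.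
have grad_decomposition :
    gradf = gradh.1 *m V Y *m moore_penrose Y + (gradh.2 *m W Y *m U^T)^T.
  rewrite gradfE gradhE /= moore_penrose_full_col_rank // !mulmxKV //.
  by rewrite !trmx_mul !trmxK addrC SE !mulmxA.
split=> //.
  rewrite gradhE proj_perpE // -/P PgradfY; congr (_, _).
  by rewrite -[X in gradf^T *m X]trmxK -trmx_mul Ugradf trmx_mul trmxK.
move=> gradh0 nabla_e nabla_q LCe LCq Hf Hh Te Tq d.
have gradf0 : gradf = 0.
  by rewrite grad_decomposition gradh0 /= !mul0mx trmx0 addr0.
(* Stationarity yields [U^T G = 0] and [P G Y = 0]; the first removes the projector from the
   second. *)
have GU : G^T *m U = 0.
  by rewrite -[LHS]trmxK trmx_mul trmxK -Ugradf gradf0 mulmx0 trmx0.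
have GY : G *m Y = 0.
  have : P *m G *m Y = 0 by rewrite -PgradfY gradf0 mulmx0 mul0mx.
  rewrite /P !mulmxBl mul1mx -!mulmxA [U^T *m _]mulmxA.
  have -> : U^T *m G = 0 by rewrite -Ugradf gradf0 mulmx0.
  by rewrite mul0mx mulmx0 subr0.
have hess_form v w : Tq v -> Tq w ->
    metric (Mq3 p1 V W) x (Hh v) w = \tr ((Hf (Lmap U Y v))^T *m Lmap U Y w).
  move=> v_hor w_hor; rewrite [RHS](rank_hessianE f_C2 (x := x)) //.
  by apply: (Mq3_hessianE f_C2) => //; exact: Mq3_gradient_field.
have Lmap_tangent v : Te (Lmap U Y v).
  by apply/tangent_rankP => //; exists v.2, v.1.
(* The coordinates are the entries of [D] and of [th.2]; matching [n] with [d], where the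
   subtraction is truncated, uses [r <= p1]. *)
pose n := ((p1 - r) * r + p2 * r)%N.
have dn : d = n.
  by rewrite /d /n -mulnDl addnBAC // (leq_trans r_le) // geq_minl.
pose phi (c : 'rV[R]_n) : factors R p1 p2 r :=
  (perp U *m vec_mx (lsubmx c), vec_mx (rsubmx c)).
have phi_linear : linear phi.
  by move=> k a b; congr (_, _); rewrite !linearP /= ?mulmxDr -?scalemxAr.
pose Phi : {linear 'rV[R]_n -> factors R p1 p2 r} :=
  HB.pack phi (GRing.isLinear.Build _ _ _ _ phi phi_linear).
have Lphi_linear : linear (fun c => Lmap U Y (phi c)).
  move=> k a b; rewrite phi_linear /Lmap /= [(_ + _)^T]linearP /= mulmxDr mulmxDl.
  by rewrite -scalemxAr -scalemxAl scalerDr addrACA.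
pose LPhi : {linear 'rV[R]_n -> 'M[R]_(p1, p2)} :=
  HB.pack (fun c => Lmap U Y (phi c))
    (GRing.isLinear.Build _ _ _ _ (fun c => Lmap U Y (phi c)) Lphi_linear).
have [perpK Uperp] := perpP U_stiefel.
have phi_inj : injective phi.
  move=> a b [/(congr1 (mulmx (perp U)^T)) + /(can_inj (@vec_mxK _ _ _)) r_eq].
  rewrite !mulmxA perpK !mul1mx => /(can_inj (@vec_mxK _ _ _)) l_eq.
  by rewrite -[a]hsubmxK -[b]hsubmxK l_eq r_eq.
have TqE : Tq = range phi.
  apply/seteqP; split=> [[a b] [D /= aD]|_ [c _ <-]]; last by exists (vec_mx (lsubmx c)).
  exists (row_mx (mxvec D) (mxvec b)) => //.
  by rewrite /phi row_mxKl row_mxKr !mxvecK -aD.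
have Tq_phi c : Tq (phi c) by rewrite TqE; exists c.
(* Multiplying by [U^T] isolates [th.2], as horizontality kills the other term; a right inverse of
   [Y^T] then isolates [th.1]. *)
have Lmap_inj v w : Tq v -> Tq w -> Lmap U Y v = Lmap U Y w -> v = w.
  move=> /(Mq3_horP _ xt) /= Uv /(Mq3_horP _ xt) /= Uw; rewrite /Lmap => vw.
  have v2 : v.2 = w.2.
    have := congr1 (mulmx U^T) vw; rewrite !mulmxDr !mulmxA UU Uv Uw !mul1mx !mul0mx !addr0.
    exact: trmx_inj.
  have := vw; rewrite v2 => /addrI/(congr1 (mulmx^~ (Y *m invmx (Y^T *m Y)))).
  rewrite -!mulmxA [Y^T *m _]mulmxA mulmxV // !mulmx1 => v1.
  by case: (v) (w) v1 v2 => ? ? [? ?] /= -> ->.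
have TeE : Te = range (fun c => Lmap U Y (phi c)).
  apply/seteqP; split=> [_ /(tangent_rankP U_stiefel Y_full)[A [B ->]]|_ [c _ <-]]; last first.
    exact: Lmap_tangent.
  (* The part [U U^T B Y^T] of the second summand is not horizontal, but it has the form [U *m _]
     and is absorbed into the second component. *)
  pose th : factors R p1 p2 r := (P *m B, A + Y *m B^T *m U).
  have : Tq th by apply/(Mq3_horP _ xt) => /=; rewrite mulmxA UP mul0mx.
  rewrite TqE => -[c _ cE]; exists c => //; rewrite cE /Lmap /= linearD /= mulmxDr.
  rewrite !trmx_mul !trmxK -addrA; congr (_ + _).
  by rewrite !mulmxA /P mulmxBl mul1mx mulmxBl addrC subrK.
have [r_p1 r_p2] : (r <= p1)%N /\ (r <= p2)%N by apply/andP; rewrite -leq_min.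
have gradq_field := Mq3_gradient_field V_spd W_spd f_C2 V_smooth W_smooth V_equiv W_equiv.
have grade_field := rank_gradient_field r f_C2.
have Xr : \rank X = r by exact: rank_mulmx_stiefel.
rewrite dn; have [] // := @intertwined_spectra_sandwich R _ _ Tq Hh (Mq3_metric V W x)
  Te Hf (fun A B => \tr (A^T *m B)) n Phi LPhi
  (Num.min (sigma r (invmx (W Y))) (sigma r (Y *m invmx (spd_sqrt (V Y))) ^+ 2))
  (Num.max (sigma 1 (invmx (W Y))) (sigma 1 (Y *m invmx (spd_sqrt (V Y))) ^+ 2)).
- by move=> u; exact: (lc_hor LCq gradq_field xt).
- by move=> c u v; exact: (lc_linear LCq c gradq_field xt).
- by move=> c u v w; exact: Mq3_metric_linear.
- by move=> u v; exact: Mq3_metric_sym.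
- by move=> u _; exact: Mq3_metric_gt0.
- by move=> a b /Lmap_inj ab; apply: phi_inj; exact: ab.
- by move=> u; exact: (lc_hor LCe grade_field Xr).
- by move=> c u v; exact: (lc_linear LCe c grade_field Xr).
- move=> c u v w; rewrite [(c *: u + v)^T]linearP /= mulmxDl -scalemxAl.
  by rewrite [LHS]linearP.
- by move=> u v; exact: mxtrace_trmulC.
- by move=> u _; exact: mxtrace_trmul_gt0.
- by move=> u v uT vT; exact: (rank_hessian_sym f_C2).
- by move=> a b; exact: hess_form.
- move=> a; apply: Lmap_sqnorm_bounds => //; first by rewrite r_gt0.
  exact: (Mq3_horP (phi a) xt).1 (Tq_phi a).
by move=> sz sw; split => // th th_hor; exact: hess_form.
Qed.
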